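(* Let $n\geq 3$ and let $L,K\subset \mathbb{R}^n$ be convex bodies. Suppose that $L\subset \operatorname{int} K$, that $L$ is $O$-symmetric, and that for every $x\in \operatorname{bd} K$ the cone $C(L,x)$ is ellipsoidal. Then $L$ is an ellipsoid.
   Context: A convex body in $\mathbb{R}^n$ is a compact convex set with nonempty interior; $\operatorname{int}$ and $\operatorname{bd}$ denote interior and boundary. $O$ is the origin, and a set $M$ is $O$-symmetric if $M=-M$. For a convex body $L$ and $x\in\mathbb{R}^n\setminus L$, the cone generated by $L$ with apex $x$ is $C(L,x):=\{x+\lambda(y-x): y\in L,\ \lambda\geq 0\}$. A convex cone is called ellipsoidal if it has one hyper-section (intersection with an affine hyperplane) which is an ($(n-1)$-dimensional solid) ellipsoid. *)

(* Defs.v *)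
From mathcomp Require Import all_boot all_order all_algebra.
From mathcomp Require Import all_classical all_reals all_analysis.

Set Implicit Arguments.
Unset Strict Implicit.
Unset Printing Implicit Defensive.

Import Order.TTheory GRing.Theory Num.Theory.
Import numFieldNormedType.Exports.

Local Open Scope classical_set_scope.
Local Open Scope ring_scope.

(* Points of R^n are row vectors. The library topology on them is that of the
   entrywise maximum norm, which is the usual topology of R^n. *)

Definition boundary (T : topologicalType) (A : set T) : set T :=
  closure A `\` A°.

Definition convex_body (R : realType) (n : nat) (K : set 'rV[R]_n) : Prop :=
  [/\ compact K, convex_set K & K° !=set0].

Definition o_symmetric (R : realType) (n : nat) (M : set 'rV[R]_n) : Prop :=
  M = [set - y | y in M].

Definition dotp (R : realType) (n : nat) (u v : 'rV[R]_n) : R :=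
  \sum_(i < n) u ord0 i * v ord0 i.

Definition euclidean_ball (R : realType) (n : nat) : set 'rV[R]_n :=
  [set u | dotp u u <= 1].

Definition hyperplane (R : realType) (n : nat) (H : set 'rV[R]_n) : Prop :=
  exists (u : 'rV[R]_n) (b : R), u != 0 /\ H = [set y | dotp u y = b].

(* A k-dimensional solid ellipsoid in R^n is the image of the closed Euclidean
   unit ball of R^k under an injective affine map R^k -> R^n; since vectors are
   rows, injectivity of u |-> u *m A is the independence of the rows of A. *)
Definition kdim_ellipsoid (R : realType) (n k : nat) (E : set 'rV[R]_n) : Prop :=
  exists (c : 'rV[R]_n) (A : 'M[R]_(k, n)),
    row_free A /\ E = [set c + u *m A | u in @euclidean_ball R k].

Definition ellipsoid (R : realType) (n : nat) (E : set 'rV[R]_n) : Prop :=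
  kdim_ellipsoid n E.

Definition gen_cone (R : realType) (n : nat) (L : set 'rV[R]_n) (x : 'rV[R]_n) :
    set 'rV[R]_n :=
  [set x + l *: (y - x) | y in L & l in [set l : R | 0 <= l]].

Definition ellipsoidal (R : realType) (n : nat) (C : set 'rV[R]_n) : Prop :=
  exists2 H : set 'rV[R]_n, hyperplane H & kdim_ellipsoid n.-1 (C `&` H).

(* Main.v *)
(* Let h be the support function of L, a norm since L = -L. The support cone of L
   at an apex x is ellipsoidal iff some quadratic form q_x has, at every v, the sign
   of h(v)^2 - (x.v)^2; L is an ellipsoid iff h^2 is a quadratic form.

   If x and y lie in a hyperplane missing L, then q_x and q_y agree, up to a positive
   factor, on the orthogonal complement of x - y. Comparing the apexes at the ends of
   chords of K through a point o outside L, one finds forms A (quadratic), m (linear)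
   and a scalar s such that q_x(v) is proportional to
   A(v) + m(v)(x.v) + s (x.v)^2 for all x of bd K on a hyperplane through o that
   misses L. This triple does not depend on the hyperplane (three of them are compared
   along their common chords through o), hence is locally constant in o, and by
   connectedness it is the same for all o in int K outside L. Every v then has an
   apex x with x.v = h(v), which gives A + m h + s h^2 = 0; as h is even, m = 0 and
   h^2 = -A/s. *)

Require Import Defs.
From mathcomp Require Import all_boot all_order all_algebra.
From mathcomp Require Import all_classical all_reals all_analysis.
From mathcomp Require Import ring lra.

Import Order.TTheory GRing.Theory Num.Theory.
Import numFieldNormedType.Exports.

Local Open Scope classical_set_scope.
Local Open Scope ring_scope.

(** * Linear and quadratic forms *)

Lemma dotp_mx {R : realType} {n : nat} (u v : 'rV[R]_n) :
  dotp u v = (u *m v^T) 0 0.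
Proof. by rewrite /dotp !mxE; apply: eq_bigr => i _; rewrite !mxE. Qed.

Lemma dotp_mulr {R : realType} {m n : nat} (u : 'rV[R]_m) (v : 'rV[R]_n)
  (A : 'M[R]_(m, n)) : dotp (u *m A) v = dotp u (v *m A^T).
Proof. by rewrite !dotp_mx trmx_mul trmxK mulmxA. Qed.

Section LinearAlgebra.
Context {R : realType} {n : nat}.
Implicit Types (a b c d e u v w x y l : 'rV[R]_n) (k s t : R).

Lemma dotpC u v : dotp u v = dotp v u.
Proof. by apply: eq_bigr => i _; rewrite mulrC. Qed.

Lemma dotpDl u v w : dotp (u + v) w = dotp u w + dotp v w.
Proof. by rewrite !dotp_mx mulmxDl mxE. Qed.

Lemma dotpZl k u w : dotp (k *: u) w = k * dotp u w.
Proof. by rewrite !dotp_mx -scalemxAl mxE. Qed.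

Lemma dotpNl u w : dotp (- u) w = - dotp u w.
Proof. by rewrite -scaleN1r dotpZl mulN1r. Qed.

Lemma dotpBl u v w : dotp (u - v) w = dotp u w - dotp v w.
Proof. by rewrite dotpDl dotpNl. Qed.

Lemma dotp0l w : dotp 0 w = 0.
Proof. by rewrite -(scale0r 0) dotpZl mul0r. Qed.

Lemma dotpDr u v w : dotp w (u + v) = dotp w u + dotp w v.
Proof. by rewrite !(dotpC w) dotpDl. Qed.

Lemma dotpZr k u w : dotp w (k *: u) = k * dotp w u.
Proof. by rewrite !(dotpC w) dotpZl. Qed.

Lemma dotpNr u w : dotp w (- u) = - dotp w u.
Proof. by rewrite !(dotpC w) dotpNl. Qed.

Lemma dotpBr u v w : dotp w (u - v) = dotp w u - dotp w v.
Proof. by rewrite !(dotpC w) dotpBl. Qed.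

Lemma dotp0r w : dotp w 0 = 0.
Proof. by rewrite dotpC dotp0l. Qed.

Definition dotpE := (dotpDl, dotpDr, dotpBl, dotpBr, dotpNl, dotpNr,
  dotpZl, dotpZr, dotp0l, dotp0r).

Lemma dotp_ge0 v : 0 <= dotp v v.
Proof. by apply: sumr_ge0 => i _; rewrite -expr2 sqr_ge0. Qed.

Lemma dotp_eq0 v : (dotp v v == 0) = (v == 0).
Proof.
apply/eqP/eqP => [v0|->]; last by rewrite dotp0l.
apply/rowP => i; rewrite mxE; apply/eqP; rewrite -sqrf_eq0 expr2; apply/eqP.
by apply: (psumr_eq0P _ v0) => // j _; rewrite -expr2 sqr_ge0.
Qed.

Lemma dotp_gt0 v : v != 0 -> 0 < dotp v v.
Proof. by move=> v0; rewrite lt_neqAle eq_sym dotp_eq0 v0 dotp_ge0. Qed.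

(** The n x 2 matrix with columns a and b has rank at most 2 < n, so its left kernel is nonzero.
    Taking a = b, or a = b = 0, yields a vector orthogonal to a, or just a nonzero one. *)
Lemma exists_orthogonal2 a b : (2 < n)%N ->
  exists v, [/\ v != 0, dotp a v = 0 & dotp b v = 0].
Proof.
move=> n2; pose A := row_mx a^T b^T.
have : kermx A != 0.
  rewrite -mxrank_eq0 mxrank_ker -lt0n subn_gt0.
  by apply: leq_ltn_trans (rank_leq_col A) _.
case/rowV0Pn => v /sub_kermxP; rewrite mul_mx_row => /eqP.
rewrite row_mx_eq0 => /andP[/eqP va /eqP vb] v0; exists v.
by split=> //; rewrite dotpC dotp_mx ?va ?vb mxE.
Qed.

Definition indep a b := forall s t, s *: a + t *: b = 0 -> s = 0 /\ t = 0.

Lemma indepC a b : indep a b -> indep b a.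
Proof. by move=> ab s t; rewrite addrC => /ab[]. Qed.

Lemma indep_neq0l {a b} : indep a b -> a != 0.
Proof.
move=> ab; apply/eqP => a0; have [|/eqP] := ab 1 0.
  by rewrite a0 scaler0 scale0r addr0.
by rewrite oner_eq0.
Qed.

Lemma indepP a b u v : dotp u a != 0 -> dotp u b = 0 -> dotp v b != 0 ->
  indep a b.
Proof.
move=> ua ub vb s t st.
have /eqP := congr1 (dotp u) st.
rewrite !dotpE ub mulr0 addr0 mulf_eq0 (negPf ua) orbF => /eqP s0.
have /eqP := congr1 (dotp v) st.
by rewrite s0 !dotpE mul0r add0r mulf_eq0 (negPf vb) orbF => /eqP.
Qed.

Lemma indep_comb a b p q r s : indep a b -> p * s - q * r != 0 ->
  indep (p *: a + q *: b) (r *: a + s *: b).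
Proof.
move=> ab D k l kl.
have [|E1 E2] := ab (k * p + l * r) (k * q + l * s).
  rewrite -kl !scalerDr !scalerDl !scalerA.
  by rewrite -!addrA; congr (_ + _); rewrite addrCA.
have k0 : (p * s - q * r) * k = s * (k * p + l * r) - r * (k * q + l * s) by ring.
have l0 : (p * s - q * r) * l = p * (k * q + l * s) - q * (k * p + l * r) by ring.
move/eqP: k0; move/eqP: l0; rewrite E1 E2 !mulr0 subr0 !mulf_eq0 (negPf D) /=.
by move=> /eqP -> /eqP ->.
Qed.

(** The vector is a multiple of the component of a orthogonal to b. It lies in the span of a and b,
    whence the last clause. *)
Lemma indep_dual a b : indep a b ->
  exists v, [/\ dotp a v = 1, dotp b v = 0 &
    forall f, dotp a f = 0 -> dotp b f = 0 -> dotp f v = 0].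
Proof.
move=> ab; have b0 := indep_neq0l (indepC _ _ ab).
pose w := dotp b b *: a - dotp a b *: b.
have w0 : w != 0.
  apply/eqP => w0; have [|/eqP] := ab (dotp b b) (- dotp a b).
    by rewrite scaleNr.
  by rewrite dotp_eq0 (negPf b0).
have bw : dotp b w = 0 by rewrite /w !dotpE (dotpC b a); ring.
have aw : dotp a w != 0.
  have := dotp_gt0 _ w0; rewrite {1}/w dotpBl !dotpZl bw mulr0 subr0.
  by move=> /lt0r_neq0; rewrite mulf_eq0 negb_or => /andP[].
exists ((dotp a w)^-1 *: w); rewrite !dotpZr bw mulr0 mulVf //; split => // f af bf.
by rewrite dotpZr /w !dotpE !(dotpC f) af bf !mulr0 subrr mulr0.
Qed.

Lemma linear_forms_mul_eq0 a b :
  (forall v, dotp a v * dotp b v = 0) -> a = 0 \/ b = 0.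
Proof.
move=> ab; have [->|a0] := eqVneq a 0; first by left.
have [->|b0] := eqVneq b 0; first by right.
have /eqP := ab a; rewrite mulf_eq0 dotp_eq0 (negPf a0) /= => /eqP ba.
have /eqP := ab (a + b); rewrite !dotpDr ba (dotpC a b) ba addr0 add0r.
by rewrite mulf_eq0 !dotp_eq0 (negPf a0) (negPf b0).
Qed.

Lemma linear_form_hyperplane a l : (forall v, dotp a v = 0 -> dotp l v = 0) ->
  exists k, l = k *: a.
Proof.
move=> al; have [a0|a0] := eqVneq a 0.
  exists 0; apply/eqP; rewrite a0 scaler0 -dotp_eq0; apply/eqP/al.
  by rewrite a0 dotp0l.
pose k := dotp a l / dotp a a; exists k.
have aa : dotp a a != 0 by rewrite dotp_eq0.
have av : dotp a (l - k *: a) = 0 by rewrite !dotpE /k; field.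
apply/eqP; rewrite -subr_eq0 -dotp_eq0 dotpBl al // dotpZl av.
by rewrite mulr0 subr0.
Qed.

(** On the hyperplane b = 0, l vanishes wherever a does not. Where a vanishes too, translating by a
    w with a.w = 1, b.w = 0, hence l.w = 0, leads back to that case. *)
Lemma linear_form_hyperplane_mul a b l : indep a b ->
  (forall v, dotp b v = 0 -> dotp a v * dotp l v = 0) -> exists k, l = k *: b.
Proof.
move=> ab H; apply: linear_form_hyperplane => v bv.
have [w [aw bw _]] := indep_dual _ _ ab.
have lw : dotp l w = 0 by have := H _ bw; rewrite aw mul1r.
have [av|av] := eqVneq (dotp a v) 0.
  have := H (v + w); rewrite !dotpDr av aw lw bv bw !add0r mul1r addr0.
  exact.
by have /eqP := H _ bv; rewrite mulf_eq0 (negPf av) /= => /eqP.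
Qed.

(** Evaluate at v with e.v = 0, at w with f.w = 0, both with d equal to 1, and at v + w: the third
    value minus the other two is 2 k1. *)
Lemma squares_indep d e f k1 k2 k3 : indep d e -> indep d f ->
  (forall v, k1 * dotp d v ^+ 2 + k2 * dotp e v ^+ 2 + k3 * dotp f v ^+ 2 = 0) ->
  k1 = 0.
Proof.
move=> de df H.
have [v [dv ev _]] := indep_dual _ _ de; have [w [dw fw _]] := indep_dual _ _ df.
have := H (v + w); have := H v; have := H w.
rewrite !dotpDr dv ev dw fw; nra.
Qed.

Definition qform (f : 'rV[R]_n -> R) :=
  exists S : 'M[R]_n, forall v, f v = dotp (v *m S) v.

Lemma qformD f g : qform f -> qform g -> qform (fun v => f v + g v).
Proof.
by move=> [S fS] [T gT]; exists (S + T) => v; rewrite fS gT mulmxDr dotpDl.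
Qed.

Lemma qformZ k f : qform f -> qform (fun v => k * f v).
Proof. by move=> [S fS]; exists (k *: S) => v; rewrite fS -scalemxAr dotpZl. Qed.

Lemma qform_mul a b : qform (fun v => dotp a v * dotp b v).
Proof.
exists (a^T *m b) => v; rewrite mulmxA [in RHS]dotp_mx.
rewrite (mx11_scalar (v *m a^T)) mul_scalar_mx -scalemxAl mxE.
by rewrite -!dotp_mx (dotpC v a).
Qed.

Lemma qform_ext f g : qform f -> (forall v, f v = g v) -> qform g.
Proof. by move=> [S fS] fg; exists S => v; rewrite -fg. Qed.

Lemma qformB f g : qform f -> qform g -> qform (fun v => f v - g v).
Proof.
move=> qf qg; apply: qform_ext (qformD _ _ qf (qformZ (-1) _ qg)) _ => v.
by rewrite mulN1r.
Qed.

Lemma qform_line f v w : qform f ->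
  exists k, forall s t, f (s *: v + t *: w) = s ^+ 2 * f v + s * t * k + t ^+ 2 * f w.
Proof.
move=> [S fS]; exists (dotp (v *m S) w + dotp (w *m S) v) => s t.
by rewrite !fS !mulmxDl -!scalemxAl !dotpE; ring.
Qed.

Lemma qform_scale f k v : qform f -> f (k *: v) = k ^+ 2 * f v.
Proof.
by move=> [S fS]; rewrite !fS -scalemxAl !dotpE; ring.
Qed.

(** Write v = w + t a with w orthogonal to a. Expanding f and using f w = 0 leaves a factor t, and l
    is the explicit cofactor. *)
Lemma qform_hyperplane f a : qform f -> a != 0 ->
  (forall v, dotp a v = 0 -> f v = 0) ->
  exists l, forall v, f v = dotp a v * dotp l v.
Proof.
move=> [S fS] a0 fa; have aa : dotp a a != 0 by rewrite dotp_eq0.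
exists ((dotp a a)^-1 *: (a *m S + a *m S^T - (dotp (a *m S) a / dotp a a) *: a)) => v.
pose t := dotp a v / dotp a a; pose w := v - t *: a.
have /fa : dotp a w = 0 by rewrite /w !dotpE /t; field.
have Sa : dotp (v *m S) a = dotp (a *m S^T) v by rewrite dotp_mulr dotpC.
rewrite fS /w mulmxBl -scalemxAl !dotpE Sa fS => E.
rewrite -[LHS]subr0 -E /t; by field.
Qed.

(** The first hyperplane gives f = a l; each of the other two forces l to be a multiple of its
    normal, so l = 0. *)
Lemma qform_three_hyperplanes f a b c : qform f ->
  indep a b -> indep a c -> indep b c ->
  (forall v, dotp a v = 0 -> f v = 0) -> (forall v, dotp b v = 0 -> f v = 0) ->
  (forall v, dotp c v = 0 -> f v = 0) -> forall v, f v = 0.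
Proof.
move=> qf ab ac bc fa fb fc v.
have [l fl] := qform_hyperplane _ _ qf (indep_neq0l ab) fa.
have [|k lk] := linear_form_hyperplane_mul a b l ab.
  by move=> w bw; rewrite -fl fb.
have [|k' lk'] := linear_form_hyperplane_mul a c l ac.
  by move=> w cw; rewrite -fl fc.
have [|k0 _] := bc k (- k'); first by rewrite -lk scaleNr -lk' subrr.
by rewrite fl lk k0 scale0r dotp0l mulr0.
Qed.

(** A candidate for the forms q_x at all apexes x simultaneously. Since x enters only through
    [dotp x v], with degree at most two, interpolation in x works as for polynomials in one
    variable. *)
Definition pencil (tau : 'rV[R]_n -> 'rV[R]_n -> R) :=
  exists (f : 'rV[R]_n -> R) m s, qform f /\
    forall x v, tau x v = f v + dotp m v * dotp x v + s * dotp x v ^+ 2.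

Lemma pencilB k tau tau' : pencil tau -> pencil tau' ->
  pencil (fun x v => tau' x v - k * tau x v).
Proof.
move=> [f [m [s [qf tE]]]] [f' [m' [s' [qf' tE']]]].
exists (fun v => f' v - k * f v), (m' - k *: m), (s' - k * s); split.
  by apply: qformB => //; exact: qformZ.
by move=> x v; rewrite tE tE' !dotpE; ring.
Qed.

Lemma pencil_qform tau x : pencil tau -> qform (tau x).
Proof.
move=> [f [m [s [qf tE]]]].
apply: (qform_ext (fun v => f v + dotp m v * dotp x v
  + s * (dotp x v * dotp x v))); last by move=> v; rewrite tE expr2.
apply: qformD; last exact/qformZ/qform_mul.
exact/qformD/qform_mul.
Qed.

Lemma pencil_eq tau x y v : pencil tau -> dotp x v = dotp y v ->
  tau x v = tau y v.
Proof. by move=> [f [m [s [_ tE]]]] xy; rewrite !tE xy. Qed.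

(** For fixed v this is a polynomial of degree at most two in [dotp w v] with two known roots, so it
    is s times the product of the root factors. [linear_forms_mul_eq0] justifies cancelling (x -
    y).v as a linear form. *)
Lemma pencil_two_zeros tau x y : pencil tau -> x != y ->
  (forall v, tau x v = 0) -> (forall v, tau y v = 0) ->
  exists k, forall w v, tau w v = k * (dotp (w - x) v * dotp (w - y) v).
Proof.
move=> [f [m [s [_ tE]]]] xy x0 y0.
have [|/eqP|/eqP] := linear_forms_mul_eq0 (x - y) (m + s *: (x + y)).
- move=> v; have := x0 v; have := y0 v; rewrite !tE !dotpE => E1 E2.
  by rewrite -[RHS](subrr 0) -{1}E2 -E1; ring.
- by rewrite subr_eq0 (negPf xy).
rewrite addr_eq0 => /eqP mE; exists s => w v.
have := x0 v; rewrite !tE mE !dotpE => E.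
by rewrite -[LHS]subr0 -E; ring.
Qed.

End LinearAlgebra.

(** * Forms attached to the apexes *)

Section Apexes.
Context {R : realType} {n : nat}.
Implicit Types (d e o u v w x y z : 'rV[R]_n) (k s t : R).

Definition adapted (h : 'rV[R]_n -> R) x (f : 'rV[R]_n -> R) :=
  forall v, Num.sg (f v) = Num.sg (h v ^+ 2 - dotp x v ^+ 2).

(* The situation of the theorem, with I = int K, B = bd K and L entering only through
   its support function h. *)
Record apex_system (h : 'rV[R]_n -> R) (I B : set 'rV[R]_n) : Prop := {
  norm_gt0 : forall v, v != 0 -> 0 < h v;
  normD : forall u v, h (u + v) <= h u + h v;
  normZ : forall k v, h (k *: v) = `|k| * h v;
  inner_open : forall o d, I o ->
    exists2 r, 0 < r & forall t, `|t| < r -> I (o + t *: d);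
  inner_convex : forall x y t, I x -> I y -> 0 <= t <= 1 ->
    I ((1 - t) *: x + t *: y);
  inner_disjoint : forall x, I x -> B x -> False;
  inner_contact : forall v, exists p,
    [/\ I p, dotp p v = h v & forall w, dotp p w <= h w];
  ray_exit : forall o d, I o -> d != 0 -> exists2 t, 0 < t & B (o + t *: d);
  apex_separated : forall x, B x -> exists w, h w < dotp x w;
  apex_form : forall x, B x -> exists2 f, qform f & adapted h x f
}.

Context {h : 'rV[R]_n -> R} {I B : set 'rV[R]_n}.
Hypothesis n2 : (2 < n)%N.
Hypothesis H : apex_system h I B.

Lemma norm0 : h 0 = 0.
Proof. by rewrite -(scale0r 0) (normZ _ _ _ H) normr0 mul0r. Qed.

Lemma norm_ge0 v : 0 <= h v.
Proof.
have [->|/(norm_gt0 _ _ _ H)/ltW//] := eqVneq v 0.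
by rewrite norm0.
Qed.

Lemma adapted_lt0 x f v : adapted h x f -> h v < dotp x v -> f v < 0.
Proof.
move=> fx hv; rewrite -sgr_cp0 fx sgr_cp0.
have := norm_ge0 v; nra.
Qed.

Lemma adapted_gt0 x f v : adapted h x f -> v != 0 -> dotp x v = 0 -> 0 < f v.
Proof.
move=> fx v0 xv; rewrite -sgr_cp0 fx sgr_cp0 xv expr0n subr0.
by rewrite exprn_gt0 // (norm_gt0 _ _ _ H).
Qed.

Lemma adapted_scale x f g k : 0 < k -> adapted h x f ->
  (forall v, g v = k * f v) -> adapted h x g.
Proof.
by move=> k0 fx gf v; rewrite gf sgrM (gtr0_sg k0) mul1r.
Qed.

Lemma quadratic_roots (a b c : R) : 0 < a -> c < 0 ->
  exists t1 t2, [/\ t1 != t2, a + t1 * b + t1 ^+ 2 * c = 0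
    & a + t2 * b + t2 ^+ 2 * c = 0].
Proof.
move=> a0 c0; pose D := b ^+ 2 - 4 * a * c.
have D0 : 0 < D by rewrite /D; nra.
have sD : Num.sqrt D ^+ 2 = D by rewrite sqr_sqrtr // ltW.
have sD0 : 0 < Num.sqrt D by rewrite sqrtr_gt0.
have cn : c != 0 by rewrite lt_eqF.
pose r s : R := (- b + s) / (2 * c).
have rE s : s ^+ 2 = D -> a + r s * b + r s ^+ 2 * c = 0.
  move=> sE; have -> : a + r s * b + r s ^+ 2 * c = (s ^+ 2 - D) / (4 * c).
    by rewrite /r /D; field.
  by rewrite sE subrr mul0r.
exists (r (Num.sqrt D)), (r (- Num.sqrt D)); split; last 2 first.
- exact: rE.
- by apply: rE; rewrite sqrrN.
rewrite -subr_eq0 /r -mulrBl mulf_neq0 ?invr_eq0 ?mulf_neq0 ?pnatr_eq0 //.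
by apply/eqP; nra.
Qed.

(* On the line through u and a vector w of the hyperplane with dotp x w = 0, both
   forms change sign at the same two distinct points, so they are proportional. *)
Lemma adapted_proportional a x u f g : qform f -> qform g ->
  dotp a u = 0 -> h u < dotp x u ->
  (forall v, dotp a v = 0 -> Num.sg (f v) = Num.sg (h v ^+ 2 - dotp x v ^+ 2)) ->
  (forall v, dotp a v = 0 -> Num.sg (g v) = Num.sg (h v ^+ 2 - dotp x v ^+ 2)) ->
  forall v, dotp a v = 0 -> f v * g u = g v * f u.
Proof.
move=> qf qg au xu fx gx v av.
have xu0 : 0 < dotp x u by apply: le_lt_trans (norm_ge0 u) xu.
pose t0 := dotp x v / dotp x u; pose w := v - t0 *: u.
have vE : v = 1 *: w + t0 *: u by rewrite scale1r subrK.
have [w0|w0] := eqVneq w 0.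
  have -> : v = t0 *: u by rewrite vE w0 scaler0 add0r.
  by rewrite !qform_scale //; ring.
have aw : dotp a w = 0 by rewrite /w !dotpE av au; ring.
have xw : dotp x w = 0 by rewrite /w !dotpE /t0; field; rewrite gt_eqF.
clearbody w.
have fw : 0 < f w.
  rewrite -sgr_cp0 fx // sgr_cp0 xw expr0n subr0.
  by rewrite exprn_gt0 // (norm_gt0 _ _ _ H).
have fu : f u < 0.
  by rewrite -sgr_cp0 fx // sgr_cp0; have := norm_ge0 u; nra.
have [k kE] := qform_line f w u qf; have [l lE] := qform_line g w u qg.
have [t1 [t2 [t12 E1 E2]]] := quadratic_roots _ k _ fw fu.
have gE t : f w + t * k + t ^+ 2 * f u = 0 -> g w + t * l + t ^+ 2 * g u = 0.
  move=> E; have at0 : dotp a (1 *: w + t *: u) = 0.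
    by rewrite !dotpE aw au; ring.
  have : Num.sg (g (1 *: w + t *: u)) = Num.sg (f (1 *: w + t *: u)).
    by rewrite fx ?gx.
  rewrite kE lE !expr1n !mul1r E sgr0 => /eqP; rewrite sgr_eq0 => /eqP //.
(* By Vieta, both forms restricted to the line are multiples of (t - t1)(t - t2), with leading
   coefficients f u and g u. *)
have G1 := gE _ E1; have G2 := gE _ E2.
have d12 : t1 - t2 != 0 by rewrite subr_eq0.
have fk : k = - (t1 + t2) * f u.
  by apply: (mulfI d12); rewrite -[LHS]subr0 -[in LHS](subrr 0) -{1}E1 -E2; ring.
have gl : l = - (t1 + t2) * g u.
  by apply: (mulfI d12); rewrite -[LHS]subr0 -[in LHS](subrr 0) -{1}G1 -G2; ring.
have fwE : f w = t1 * t2 * f u by rewrite -[LHS]subr0 -E1 fk; ring.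
have gwE : g w = t1 * t2 * g u by rewrite -[LHS]subr0 -G1 gl; ring.
by rewrite vE kE lE fk gl fwE gwE; ring.
Qed.

(** Fixing the value at u removes the free positive factor, so forms at different apexes can be
    compared by equality. *)
Lemma normalized_form x u : B x -> h u < dotp x u ->
  exists f, [/\ qform f, adapted h x f & f u = -1].
Proof.
move=> /(apex_form _ _ _ H)[f qf fx] xu; have fu := adapted_lt0 _ _ _ fx xu.
exists (fun v => - (f u)^-1 * f v); split.
- exact: qformZ.
- by apply: (adapted_scale _ f _ (- (f u)^-1)) => //; rewrite oppr_gt0 invr_lt0.
- by rewrite mulNr mulVf // lt_eqF.
Qed.

(** On the orthogonal complement of x - y the two sign conditions coincide, so f and g are
    proportional there; u belongs to it, and the common value at u makes the factor 1. *)
Lemma normalized_form_eq x y u f g : qform f -> qform g ->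
  adapted h x f -> adapted h y g -> f u = -1 -> g u = -1 ->
  h u < dotp x u -> dotp y u = dotp x u ->
  forall v, dotp x v = dotp y v -> f v = g v.
Proof.
move=> qf qg fx gy fu gu xu yx v xy.
have := adapted_proportional (x - y) x u f g qf qg; rewrite fu gu => E.
have /eqP : f v * -1 = g v * -1.
  apply: E => //; first by rewrite dotpBl yx subrr.
  - by move=> w /eqP; rewrite dotpBl subr_eq0 => /eqP xw; rewrite gy xw.
  - by rewrite dotpBl xy subrr.
by rewrite !mulrN1 eqr_opp => /eqP.
Qed.

(** With a = 0 in [adapted_proportional] the two forms at x are proportional everywhere. Their
    ratio, read off at u, depends on x only through [dotp x u], hence is the same along the
    hyperplane. *)
Lemma pencil_ratio tau tau' u x0 : pencil tau -> pencil tau' ->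
  h u < dotp x0 u -> adapted h x0 (tau x0) -> adapted h x0 (tau' x0) ->
  exists2 k, 0 < k & forall x, dotp x u = dotp x0 u ->
    adapted h x (tau x) -> adapted h x (tau' x) ->
    forall v, tau' x v = k * tau x v.
Proof.
move=> pt pt' x0u tx0 tx0'.
have t0 := adapted_lt0 _ _ _ tx0 x0u; have t0' := adapted_lt0 _ _ _ tx0' x0u.
exists (tau' x0 u / tau x0 u).
  by rewrite -mulrNN -invrN divr_gt0 // oppr_gt0.
move=> x xx0 tx tx' v.
have := adapted_proportional 0 x u (tau x) (tau' x) (pencil_qform _ x pt)
  (pencil_qform _ x pt').
rewrite dotp0l xx0 => /(_ erefl x0u (fun v _ => tx v) (fun v _ => tx' v) v).
rewrite dotp0l => /(_ erefl).
rewrite (pencil_eq _ _ _ _ pt xx0) (pencil_eq _ _ _ _ pt' xx0) => E.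
have : tau x0 u != 0 by rewrite lt_eqF.
by move=> ?; rewrite mulrAC (mulrC (tau' _ _)) E mulfK.
Qed.

(* A chord through o is encoded by one end o + d and the ratio b of the other half. *)
Definition chord o d b := [/\ 0 < b, B (o + d) & B (o - b *: d)].

Definition adapted_chord (tau : 'rV[R]_n -> 'rV[R]_n -> R) o d b :=
  adapted h (o + d) (tau (o + d)) /\ adapted h (o - b *: d) (tau (o - b *: d)).

Lemma chord_exists o d : I o -> d != 0 ->
  exists k b, 0 < k /\ chord o (k *: d) b.
Proof.
move=> Io d0; have [k k0 Bk] := ray_exit _ _ _ H _ _ Io d0.
have [|b b0 Bb] := ray_exit _ _ _ H o (- (k *: d)) Io.
  by rewrite oppr_eq0 scaler_eq0 negb_or d0 gt_eqF.
by exists k, b; split => //; split => //; rewrite -scalerN.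
Qed.

(** The condition [h u < dotp o u] says that the hyperplane through o normal to u misses L. It
    contains the four chord ends. A pencil is interpolated through the normalized forms at three of
    them; the agreements on hyperplanes then force the fourth. *)
Lemma pencil_exists o u d e b c : h u < dotp o u ->
  dotp d u = 0 -> dotp e u = 0 -> indep d e ->
  chord o d b -> chord o e c ->
  exists tau, [/\ pencil tau, adapted_chord tau o d b & adapted_chord tau o e c].
Proof.
move=> ou du eu de [b0 Bx Bx'] [c0 By By'].
have onP x : dotp x u = dotp o u -> h u < dotp x u by move=> ->.
have xu : dotp (o + d) u = dotp o u by rewrite dotpE du addr0.
have x'u : dotp (o - b *: d) u = dotp o u by rewrite !dotpE du mulr0 subr0.
have yu : dotp (o + e) u = dotp o u by rewrite dotpE eu addr0.
have y'u : dotp (o - c *: e) u = dotp o u by rewrite !dotpE eu mulr0 subr0.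
have [f [qf fx fu]] := normalized_form _ _ Bx (onP _ xu).
have [f' [qf' fx' fu']] := normalized_form _ _ Bx' (onP _ x'u).
have [g [qg gy gu]] := normalized_form _ _ By (onP _ yu).
have [g' [qg' gy' gu']] := normalized_form _ _ By' (onP _ y'u).
have xx' v : dotp (o + d) v = dotp (o - b *: d) v -> f v = f' v.
  by apply: (normalized_form_eq _ _ u) => //; rewrite ?xu ?x'u.
have xy v : dotp (o + d) v = dotp (o + e) v -> f v = g v.
  by apply: (normalized_form_eq _ _ u) => //; rewrite ?xu ?yu.
have x'y v : dotp (o - b *: d) v = dotp (o + e) v -> f' v = g v.
  by apply: (normalized_form_eq _ _ u) => //; rewrite ?x'u ?yu.
have xy' v : dotp (o + d) v = dotp (o - c *: e) v -> f v = g' v.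
  by apply: (normalized_form_eq _ _ u) => //; rewrite ?xu ?y'u.
have x'y' v : dotp (o - b *: d) v = dotp (o - c *: e) v -> f' v = g' v.
  by apply: (normalized_form_eq _ _ u) => //; rewrite ?x'u ?y'u.
have yy' v : dotp (o + e) v = dotp (o - c *: e) v -> g v = g' v.
  by apply: (normalized_form_eq _ _ u) => //; rewrite ?yu ?y'u.
have [l lE] : exists l, forall v, f' v - f v = dotp d v * dotp l v.
  apply: qform_hyperplane; [exact: qformB|exact: indep_neq0l de|].
  by move=> v dv; rewrite xx' ?subrr // !dotpE dv; ring.
have [l' lE'] : exists l, forall v, g v - f v = dotp (e - d) v * dotp l v.
  apply: qform_hyperplane; [exact: qformB| |].
    rewrite subr_eq0; apply/eqP => ed; have [|/eqP] := de 1 (-1).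
      by rewrite ed scaleNr subrr.
    by rewrite oner_eq0.
  by move=> v dv; rewrite xy ?subrr // !dotpE; move: dv; rewrite !dotpE; lra.
have b1 : 1 + b != 0 by rewrite gt_eqF // addr_gt0.
(* Compatibility of f' and g: they agree where e + b d vanishes, which is the difference of their
   apexes, so there d times (1 + b) l' + l is zero. *)
have [k kE] : exists k, (1 + b) *: l' + l = k *: (e + b *: d).
  apply: (linear_form_hyperplane_mul d).
    have : indep (1 *: d + 0 *: e) (b *: d + 1 *: e).
      by apply: indep_comb => //; rewrite mul1r mul0r subr0 oner_eq0.
    by rewrite !scale1r scale0r addr0 [b *: d + e]addrC.
  move=> v; rewrite !dotpE => ev.
  have fg : f' v = g v by apply: x'y; rewrite !dotpE; lra.
  have := lE v; have := lE' v; rewrite fg !dotpE => -> /eqP.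
  rewrite -subr_eq0 => /eqP E; rewrite -[RHS]oppr0 -E.
  have -> : dotp e v = - (b * dotp d v) by lra.
  ring.
(* Newton interpolation: N is the divided difference between o + d and o - b d, and s is chosen to
   fit g at o + e. *)
pose N := - ((1 + b)^-1 *: l); pose s := k / (1 + b).
pose tau x v := f v + dotp (x - (o + d)) v * dotp N v
  + s * (dotp (x - (o + d)) v * dotp (x - (o - b *: d)) v).
have tx v : tau (o + d) v = f v.
  by rewrite /tau subrr dotp0l; ring.
have tx' v : tau (o - b *: d) v = f' v.
  rewrite /tau /N -[f' v](subrK (f v)) lE !dotpE; by field.
have ty v : tau (o + e) v = g v.
  have := congr1 (fun z => dotp z v) kE; rewrite /= !dotpE => kv.
  have lv : dotp l' v = (k * (dotp e v + b * dotp d v) - dotp l v) / (1 + b).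
    by apply: (mulfI b1); rewrite mulrCA divff // mulr1 -kv addrK.
  rewrite /tau /N /s -[g v](subrK (f v)) lE' lv !dotpE; by field.
have pt : pencil tau.
  exists (fun v => f v - dotp (o + d) v * dotp N v
    + s * (dotp (o + d) v * dotp (o - b *: d) v)),
    (N - s *: (o + d + (o - b *: d))), s; split.
    apply: qformD; last exact/qformZ/qform_mul.
    exact/qformB/qform_mul.
  by move=> x v; rewrite /tau !dotpE; ring.
(* At the fourth end, the form of the pencil agrees with g' on the orthogonal complements of the
   differences to the three other ends, which are pairwise independent. *)
have ty' v : tau (o - c *: e) v = g' v.
  apply/eqP; rewrite -subr_eq0; apply/eqP; move: v.
  have ci p q r s' : p * s' - q * r != 0 ->
    indep (p *: d + q *: e) (r *: d + s' *: e) by exact: indep_comb.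
  have tz z f0 v : (forall v, tau z v = f0 v) ->
      (dotp z v = dotp (o - c *: e) v -> f0 v = g' v) ->
      dotp z v = dotp (o - c *: e) v -> tau (o - c *: e) v - g' v = 0.
    by move=> tz fg' zv; rewrite -(pencil_eq _ _ _ _ pt zv) tz fg' // subrr.
  apply: (qform_three_hyperplanes _ (1 *: d + c *: e) (- b *: d + c *: e)
     (0 *: d + 1 *: e)).
  - by apply: qformB => //; exact: pencil_qform.
  - apply: ci; have -> : 1 * c - c * - b = c * (1 + b) by ring.
    by rewrite mulf_neq0 // gt_eqF.
  - by apply: ci; rewrite mulr0 subr0 mul1r oner_eq0.
  - by apply: ci; rewrite mulr0 subr0 mulr1 oppr_eq0 gt_eqF.
  - move=> v; rewrite !dotpE => E; apply: (tz _ _ _ tx (xy' v)).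
    by rewrite !dotpE; lra.
  - move=> v; rewrite !dotpE => E; apply: (tz _ _ _ tx' (x'y' v)).
    by rewrite !dotpE; lra.
  - move=> v; rewrite !dotpE => E; apply: (tz _ _ _ ty (yy' v)).
    by rewrite !dotpE; nra.
by exists tau; split => //; split => v; rewrite ?tx ?tx' ?ty ?ty'.
Qed.

End Apexes.

(** * Pencils adapted to the apexes of a hyperplane *)

Section Pencils.
Context {R : realType} {n : nat}.
Implicit Types (d e o u v w x y z : 'rV[R]_n) (k s t : R).
Implicit Types tau : 'rV[R]_n -> 'rV[R]_n -> R.

Lemma indep_or_collinear d e : d != 0 -> indep e d \/ exists k, e = k *: d.
Proof.
move=> d0; have [|ed] := pselect (indep e d); [by left|right].
have [s [t [st nst]]] : exists s t, s *: e + t *: d = 0 /\ ~ (s = 0 /\ t = 0).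
  apply: contrapT => N; apply: ed => s t st; apply: contrapT => nst.
  by apply: N; exists s, t.
have [s0|s0] := eqVneq s 0.
  case: nst; split => //; move: st; rewrite s0 scale0r add0r => /eqP.
  by rewrite scaler_eq0 (negPf d0) orbF => /eqP.
exists (- (s^-1 * t)); rewrite scaleNr -scalerA; apply/eqP.
rewrite -subr_eq0 opprK -[X in X + _](scalerK s0) -scalerDr.
by rewrite st scaler0.
Qed.

Lemma indep_scale d e k s : k != 0 -> s != 0 -> indep d e ->
  indep (k *: d) (s *: e).
Proof.
move=> k0 s0 de p q; rewrite !scalerA => /de[/eqP + /eqP].
by rewrite !mulf_eq0 (negPf k0) (negPf s0) !orbF => /eqP -> /eqP ->.
Qed.

Lemma chord_ends_neq o d k : d != 0 -> 0 < k -> o + d != o - k *: d.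
Proof.
move=> d0 k0; rewrite -subr_eq0 opprD opprK addrACA subrr add0r.
by rewrite -{1}[d]scale1r -scalerDl scaler_eq0 negb_or d0 gt_eqF // addr_gt0.
Qed.

Context {h : 'rV[R]_n -> R} {I B : set 'rV[R]_n}.
Hypothesis n2 : (2 < n)%N.
Hypothesis H : apex_system h I B.

Lemma separator_neq0 o u : h u < dotp o u -> u != 0.
Proof.
by move=> ou; apply: contraTneq ou => ->; rewrite dotp0r (norm0 H) ltxx.
Qed.

Lemma adapted_chord_scale tau tau' o d b k : 0 < k ->
  (forall x v, tau' x v = k * tau x v) ->
  adapted_chord tau o d b (h := h) -> adapted_chord tau' o d b (h := h).
Proof.
by move=> k0 E [a a']; split; [exact: adapted_scale a (E _)
  |exact: adapted_scale a' (E _)].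
Qed.

(** Both ends lie on one hyperplane missing L, so the ratio c is the same at both; tau' - c tau is
    then a pencil vanishing at two apexes. *)
Lemma adapted_chord_difference tau tau' o u d b :
  h u < dotp o u -> dotp d u = 0 -> d != 0 -> 0 < b ->
  pencil tau -> pencil tau' ->
  adapted_chord tau o d b (h := h) -> adapted_chord tau' o d b (h := h) ->
  exists c k, 0 < c /\ forall w v, tau' w v = c * tau w v
    + k * (dotp (w - (o + d)) v * dotp (w - (o - b *: d)) v).
Proof.
move=> ou du d0 b0 pt pt' [tx ty] [tx' ty'].
have xu : dotp (o + d) u = dotp o u by rewrite dotpE du addr0.
have yu : dotp (o - b *: d) u = dotp o u by rewrite !dotpE du mulr0 subr0.
have [|c c0 cE] := pencil_ratio H tau tau' u (o + d) pt pt' _ tx tx'.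
  by rewrite xu.
have [|v|v|k kE] := pencil_two_zeros _ (o + d) (o - b *: d) (pencilB c _ _ pt pt').
- exact: chord_ends_neq.
- by rewrite cE ?subrr.
- by rewrite cE ?subrr // yu.
by exists c, k; split => // w v; rewrite -kE addrC subrK.
Qed.

(* Subtracting the three relations between the pencils leaves, at the common point o,
   a multiple of tau1 o written in the squares of the d_i; if that multiple were
   nonzero, its values at the u_i would make tau1 o nonpositive, but it is positive
   at any v orthogonal to o and d2. *)
Lemma three_chords o d1 d2 d3 b1 b2 b3 u1 u2 u3 tau1 tau2 tau3 :
  0 < b1 -> 0 < b2 -> 0 < b3 ->
  indep d1 d2 -> indep d1 d3 -> indep d2 d3 ->
  h u1 < dotp o u1 -> h u2 < dotp o u2 -> h u3 < dotp o u3 ->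
  dotp d2 u1 = 0 -> dotp d3 u1 = 0 -> dotp d1 u2 = 0 ->
  dotp d3 u2 = 0 -> dotp d1 u3 = 0 -> dotp d2 u3 = 0 ->
  dotp d1 u1 = 0 \/ [/\ dotp d1 u1 != 0, dotp d2 u2 != 0 & dotp d3 u3 != 0] ->
  pencil tau1 -> pencil tau2 -> pencil tau3 ->
  adapted_chord tau1 o d2 b2 (h := h) -> adapted_chord tau1 o d3 b3 (h := h) ->
  adapted_chord tau2 o d1 b1 (h := h) -> adapted_chord tau2 o d3 b3 (h := h) ->
  adapted_chord tau3 o d1 b1 (h := h) -> adapted_chord tau3 o d2 b2 (h := h) ->
  exists2 c, 0 < c & forall w v, tau2 w v = c * tau1 w v.
Proof.
move=> b1_gt0 b2_gt0 b3_gt0 d12 d13 d23 o1 o2 o3 e21 e31 e12 e32 e13 e23 scale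
  pt1 pt2 pt3 a12 a13 a21 a23 a31 a32.
have [c [k3 [c0 E21]]] := adapted_chord_difference _ _ _ _ _ _ o1 e31
  (indep_neq0l (indepC _ _ d13)) b3_gt0 pt1 pt2 a13 a23.
have [c' [k2 [c'0 E31]]] := adapted_chord_difference _ _ _ _ _ _ o1 e21
  (indep_neq0l d23) b2_gt0 pt1 pt3 a12 a32.
have [c'' [k1 [c''0 E32]]] := adapted_chord_difference _ _ _ _ _ _ o2 e12
  (indep_neq0l d12) b1_gt0 pt2 pt3 a21 a31.
have P d b v : dotp (o - (o + d)) v * dotp (o - (o - b *: d)) v =
    - (b * dotp d v ^+ 2) by rewrite !dotpE; ring.
have key v : (c' - c'' * c) * tau1 o v =
    - (c'' * k3 * (b3 * dotp d3 v ^+ 2) + k1 * (b1 * dotp d1 v ^+ 2)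
       - k2 * (b2 * dotp d2 v ^+ 2)).
  have := E32 o v; rewrite E31 E21 !P; nra.
have t1u1 : tau1 o u1 < 0.
  rewrite (pencil_eq _ o (o + d2) u1 pt1); last by rewrite dotpE e21 addr0.
  by apply: (adapted_lt0 H) a12.1 _; rewrite dotpE e21 addr0.
have t2u2 : tau2 o u2 < 0.
  rewrite (pencil_eq _ o (o + d3) u2 pt2); last by rewrite dotpE e32 addr0.
  by apply: (adapted_lt0 H) a23.1 _; rewrite dotpE e32 addr0.
have t3u3 : tau3 o u3 < 0.
  rewrite (pencil_eq _ o (o + d2) u3 pt3); last by rewrite dotpE e23 addr0.
  by apply: (adapted_lt0 H) a32.1 _; rewrite dotpE e23 addr0.
have cE : c' - c'' * c = 0.
  apply/eqP/negP => /negP D0; set D := c' - _ in key D0; clearbody D.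
  have K1 := key u1; rewrite e31 e21 in K1.
  (* Either d1 also lies in the first hyperplane, and [key] at u1 is already contradictory, or each
     d_i is transversal to its own hyperplane and [key] at the u_i gives the signs of the three
     coefficients. *)
  case: scale => [e11|[n1 n2' n3]].
    have : D * tau1 o u1 != 0 by rewrite mulf_neq0 // lt_eqF.
    by rewrite K1 e11 => /eqP; apply; ring.
  have K2 := key u2; rewrite e32 e12 in K2.
  have K3 := key u3; rewrite e13 e23 in K3.
  have t1u2 : tau1 o u2 < 0.
    have := E21 o u2; rewrite P e32 => E; move: t2u2; rewrite E; nra.
  have t1u3 : tau1 o u3 < 0.
    have := E31 o u3; rewrite P e23 => E; move: t3u3; rewrite E; nra.
  have sq d v : dotp d v != 0 -> 0 < dotp d v ^+ 2.
    by move=> ?; rewrite lt_neqAle eq_sym sqrf_eq0 sqr_ge0 andbT.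
  have [v [v0 ov dv]] := exists_orthogonal2 o d2 n2.
  have t1v : 0 < tau1 o v.
    rewrite (pencil_eq _ o (o + d2) v pt1); last by rewrite dotpE dv addr0.
    by apply: (adapted_gt0 H) a12.1 v0 _; rewrite dotpE ov dv addr0.
  have coef (a s p T : R) : 0 < s -> T < 0 -> 0 < p -> D * T = - (a * (p * s)) ->
      0 < a / D.
    move=> s0 T0 p0 E; have -> : a / D = - T / (p * s).
      have sp : p * s != 0 by rewrite mulf_neq0 // gt_eqF.
      by apply/eqP; rewrite eqr_div //; apply/eqP; rewrite mulNr (mulrC T) E opprK.
    by rewrite divr_gt0 ?oppr_gt0 // mulr_gt0.
  have A1 : 0 < k1 / D.
    by apply: coef (sq _ _ n1) t1u1 b1_gt0 _; rewrite K1; ring.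
  have A2 : 0 < (- k2) / D.
    by apply: coef (sq _ _ n2') t1u2 b2_gt0 _; rewrite K2; ring.
  have A3 : 0 < (c'' * k3) / D.
    by apply: coef (sq _ _ n3) t1u3 b3_gt0 _; rewrite K3; ring.
  suff : tau1 o v <= 0 by rewrite leNgt t1v.
  have -> : tau1 o v = - ((c'' * k3) / D * (b3 * dotp d3 v ^+ 2)
     + k1 / D * (b1 * dotp d1 v ^+ 2) + (- k2) / D * (b2 * dotp d2 v ^+ 2)).
    by apply: (mulfI D0); rewrite key; field; exact: D0.
  have nn a b d : 0 < a -> 0 < b -> 0 <= a * (b * dotp d v ^+ 2).
    by move=> /ltW a0 /ltW b0; rewrite mulr_ge0 // mulr_ge0 // sqr_ge0.
  by rewrite oppr_le0 !addr_ge0 // nn.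
exists c => // w v; rewrite E21.
suff -> : k3 = 0 by rewrite mul0r addr0.
(* With the left side of [key] gone, a combination of the squares of d1, d2, d3 vanishes
   identically. *)
have : c'' * k3 * b3 = 0.
  apply: (squares_indep d3 d1 d2 _ (k1 * b1) (- (k2 * b2)) (indepC _ _ d13)
    (indepC _ _ d23)) => v'.
  have := key v'; rewrite cE mul0r; lra.
by move/eqP; rewrite !mulf_eq0 (gt_eqF c''0) (gt_eqF b3_gt0) orbF => /eqP.
Qed.

Lemma hyperplane_chords o u : I o -> exists d e b c,
  [/\ dotp d u = 0, dotp e u = 0, indep d e, chord o d b (B := B)
    & chord o e c (B := B)].
Proof.
move=> Io; have [d [d0 ud _]] := exists_orthogonal2 u u n2.
have [e [e0 ue de]] := exists_orthogonal2 u d n2.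
have [k [b [k0 ch]]] := chord_exists H _ _ Io d0.
have [s [c [s0 ch']]] := chord_exists H _ _ Io e0.
exists (k *: d), (s *: e), b, c; split => //.
- by rewrite dotpZl dotpC ud mulr0.
- by rewrite dotpZl dotpC ue mulr0.
- by apply: indep_scale; rewrite ?gt_eqF //; apply: (indepP _ _ d e);
    rewrite ?dotp_eq0.
Qed.

(** [three_chords] is applied with u1 = u2 = u3 = u: an auxiliary pencil interpolated on d1 and d3
    must be proportional to tau, so tau inherits its adaptedness along d1. *)
Lemma adapted_third_chord o u d1 d2 d3 b1 b2 b3 tau : h u < dotp o u ->
  dotp d1 u = 0 -> dotp d2 u = 0 -> dotp d3 u = 0 ->
  indep d1 d2 -> indep d1 d3 -> indep d2 d3 ->
  chord o d1 b1 (B := B) -> chord o d2 b2 (B := B) -> chord o d3 b3 (B := B) ->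
  pencil tau -> adapted_chord tau o d2 b2 (h := h) ->
  adapted_chord tau o d3 b3 (h := h) -> adapted_chord tau o d1 b1 (h := h).
Proof.
move=> ou u1 u2 u3 d12 d13 d23 c1 c2 c3 pt a2 a3.
have [t2 [pt2 a21 a23]] := pencil_exists H _ _ _ _ _ _ ou u1 u3 d13 c1 c3.
have [t3 [pt3 a31 a32]] := pencil_exists H _ _ _ _ _ _ ou u1 u2 d12 c1 c2.
have [[b1_gt0 _ _] [b2_gt0 _ _] [b3_gt0 _ _]] := And3 c1 c2 c3.
have [c c0 cE] := three_chords _ _ _ _ _ _ _ _ _ _ _ _ _ b1_gt0 b2_gt0 b3_gt0
  d12 d13 d23 ou ou ou u2 u3 u1 u3 u1 u2 (or_introl u1) pt pt2 pt3
  a2 a3 a21 a23 a31 a32.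
apply: (adapted_chord_scale t2 _ _ _ _ c^-1) => //; first by rewrite invr_gt0.
by move=> x v; rewrite cE mulKf // gt_eqF.
Qed.

(** The pencil is interpolated on two chords through o; any other apex x of the hyperplane ends a
    chord through o, to which [adapted_third_chord] extends it. *)
Lemma hyperplane_pencil o u : I o -> h u < dotp o u -> exists2 tau, pencil tau &
  forall x, B x -> dotp x u = dotp o u -> adapted h x (tau x).
Proof.
move=> Io ou; have [d [e [b [c [du eu de cd ce]]]]] := hyperplane_chords o u Io.
have [tau [pt ad ae]] := pencil_exists H _ _ _ _ _ _ ou du eu de cd ce.
exists tau => // x Bx xu; pose f := x - o.
have fu : dotp f u = 0 by rewrite /f dotpBl xu subrr.
have xE : x = o + f by rewrite /f addrC subrK.
have f0 : f != 0.
  rewrite subr_eq0; apply/eqP => xo.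
  by apply: (inner_disjoint _ _ _ H o) => //; rewrite -xo.
have [|t t0 Bt] := ray_exit _ _ _ H o (- f) Io; first by rewrite oppr_eq0.
have cf : chord o f t (B := B) by split; rewrite -?xE // -scalerN.
suff : adapted_chord tau o f t (h := h) by rewrite xE; case.
(* The chord through x may be collinear with d or e; a further chord g along d + e then replaces
   that one. *)
have de0 : d + e != 0.
  apply/eqP => s0; have [|/eqP] := de 1 1; first by rewrite !scale1r.
  by rewrite oner_eq0.
have [s [r [s0 cg]]] := chord_exists H o (d + e) Io de0.
set g := s *: (d + e) in cg.
have gE : g = s *: d + s *: e by rewrite /g scalerDr.
have gd : indep g d.
  have := indep_comb _ _ s s 1 0 de; rewrite scale1r scale0r addr0 gE; apply.
  by rewrite mulr0 mulr1 sub0r oppr_eq0 gt_eqF.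
have ge : indep g e.
  have := indep_comb _ _ s s 0 1 de; rewrite scale1r scale0r add0r gE; apply.
  by rewrite mulr0 mulr1 subr0 gt_eqF.
have gu : dotp g u = 0 by rewrite gE !dotpE du eu !mulr0 addr0.
clearbody g.
have ag := adapted_third_chord _ _ _ _ _ _ _ _ _ ou gu du eu gd ge de cg cd ce pt ad ae.
have multiple k c' : f = k *: c' -> forall y, indep c' y -> indep f y.
  move=> fk y cy; rewrite fk -[y]scale1r; apply: indep_scale => //.
  by apply: contraNneq f0 => k0; rewrite fk k0 scale0r.
have [fd|[k fk]] := indep_or_collinear d f (indep_neq0l de).
  have [fe|[k fk]] := indep_or_collinear e f (indep_neq0l (indepC _ _ de)).
    exact: (adapted_third_chord _ _ _ _ _ _ _ _ _ ou fu du eu fd fe de cf cd ce).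
  have fg := multiple _ _ fk _ (indepC _ _ ge).
  exact: (adapted_third_chord _ _ _ _ _ _ _ _ _ ou fu du gu fd fg
    (indepC _ _ gd) cf cd cg).
have fe := multiple _ _ fk _ de; have fg := multiple _ _ fk _ (indepC _ _ gd).
exact: (adapted_third_chord _ _ _ _ _ _ _ _ _ ou fu eu gu fe fg
  (indepC _ _ ge) cf ce cg).
Qed.

Lemma hyperplane_pencil_unique o u tau tau' : I o -> h u < dotp o u ->
  pencil tau -> pencil tau' ->
  (forall x, B x -> dotp x u = dotp o u -> adapted h x (tau x)) ->
  (forall x, B x -> dotp x u = dotp o u -> adapted h x (tau' x)) ->
  exists2 c, 0 < c & forall w v, tau' w v = c * tau w v.
Proof.
move=> Io ou pt pt' a a'.
have [d [e [b [c [du eu de [b0 Bx Bx'] [c0 By By']]]]]] := hyperplane_chords o u Io.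
have xu : dotp (o + d) u = dotp o u by rewrite dotpE du addr0.
have x'u : dotp (o - b *: d) u = dotp o u by rewrite !dotpE du mulr0 subr0.
have yu : dotp (o + e) u = dotp o u by rewrite dotpE eu addr0.
have ax := a _ Bx xu; have ax' := a' _ Bx xu.
have [|k k0 kE] := pencil_ratio H tau tau' u (o + d) pt pt' _ ax ax'.
  by rewrite xu.
have Q x v : B x -> dotp x u = dotp o u -> tau' x v - k * tau x v = 0.
  by move=> Bz zu; rewrite kE ?subrr ?zu ?xu //; [exact: a|exact: a'].
have [|v|v|s sE] := pencil_two_zeros _ (o + d) (o - b *: d) (pencilB k _ _ pt pt').
- by apply: chord_ends_neq => //; exact: indep_neq0l de.
- exact: Q.
- exact: Q.
(* The difference also vanishes at o + e, which is not on the chord along d, so neither root factor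
   is zero there. *)
have s0 : s = 0.
  apply/eqP/negP => /negP s0.
  have [v|E|E] := linear_forms_mul_eq0 (o + e - (o + d)) (o + e - (o - b *: d)).
  - by apply: (mulfI s0); rewrite mulr0 -sE Q.
  - have [|/eqP] := de (-1) 1; last by rewrite oppr_eq0 oner_eq0.
    by rewrite scaleN1r scale1r -E opprD addrACA subrr add0r addrC.
  - have [|_ /eqP] := de b 1; last by rewrite oner_eq0.
    by rewrite scale1r -E opprD opprK addrACA subrr add0r addrC.
exists k => // w v; apply/eqP; rewrite -subr_eq0; apply/eqP.
by rewrite sE s0 mul0r.
Qed.

End Pencils.

(** * Propagation of the pencil *)

Section Propagation.
Context {R : realType} {n : nat}.
Implicit Types (d e f o u v w x y z : 'rV[R]_n) (k s t r : R).
Implicit Types tau : 'rV[R]_n -> 'rV[R]_n -> R.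

(** Connectedness of the unit interval: local constancy carries P to the supremum of the points
    where it holds, and beyond it if that supremum is below 1. *)
Lemma unit_interval_ind (P : R -> Prop) : P 0 ->
  (forall t, 0 <= t <= 1 -> exists2 r, 0 < r &
    forall t', 0 <= t' <= 1 -> `|t' - t| < r -> (P t <-> P t')) -> P 1.
Proof.
move=> P0 PE; pose A := [set t | 0 <= t <= 1 /\ P t].
have A0 : A 0 by split => //; rewrite lexx ler01.
have ubA : ubound A 1 by move=> t [/andP[]].
have hA : has_sup A by split; [exists 0|exists 1].
have s01 : 0 <= sup A <= 1.
  by rewrite (sup_upper_bound hA) //= ge_sup //; exists 0.
have [r r0 rP] := PE _ s01.
have [a [a01 Pa] ra] := sup_adherent r0 hA.
have as_ : a <= sup A by apply: sup_upper_bound.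
have Ps : P (sup A).
  by apply/(rP _ a01) => //; rewrite ler0_norm ?subr_le0 //; lra.
have [s1|s1] := ltP (sup A) 1; last first.
  by have <- : sup A = 1 by lra.
pose b := Num.min 1 (sup A + r / 2).
have bs : sup A < b by rewrite lt_min s1 /=; lra.
have b1 : b <= 1 by rewrite ge_min lexx.
have br : b <= sup A + r / 2 by rewrite ge_min lexx orbT.
have b01 : 0 <= b <= 1 by apply/andP; split; lra.
have : A b.
  by split => //; apply/(rP _ b01) => //; rewrite ger0_norm; lra.
by move=> /(sup_upper_bound hA); lra.
Qed.

Context {h : 'rV[R]_n -> R} {I B : set 'rV[R]_n}.
Hypothesis n2 : (2 < n)%N.
Hypothesis H : apex_system h I B.

Definition adapted_from tau o := pencil tau /\ forall u x, h u < dotp o u ->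
  B x -> dotp x u = dotp o u -> adapted h x (tau x).

Lemma separator_open o u f : h u < dotp o u -> exists2 r, 0 < r &
  forall t, `|t| < r -> h (u + t *: f) < dotp o (u + t *: f).
Proof.
(* Along f, the two sides of the inequality vary at rates at most h f and |o.f|; the added 1 keeps c
   positive. *)
move=> ou; pose c := h f + `|dotp o f| + 1.
have c0 : 0 < c.
  by rewrite /c ltr_wpDl // addr_ge0 // (norm_ge0 H).
exists ((dotp o u - h u) / c); first by rewrite divr_gt0 // subr_gt0.
move=> t; rewrite ltr_pdivlMr // => tc.
apply: le_lt_trans (normD _ _ _ H _ _) _; rewrite (normZ _ _ _ H) !dotpE.
have : - (`|t| * `|dotp o f|) <= t * dotp o f.
  by rewrite lerNl -normrM -normrN ler_norm.
have := normr_ge0 t; move: tc; rewrite /c; nra.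
Qed.

Lemma separator_indep o u : h u < dotp o u ->
  exists2 v, h v < dotp o v & indep u v.
Proof.
move=> ou; have u0 := separator_neq0 H _ _ ou.
have [f [f0 uf _]] := exists_orthogonal2 u u n2.
have [r r0 rP] := separator_open o u f ou.
have r2 : `|r / 2| < r by rewrite gtr0_norm; lra.
exists (u + (r / 2) *: f); first exact: rP.
have uu : dotp u u != 0 by rewrite dotp_eq0.
have ff : dotp f f != 0 by rewrite dotp_eq0.
have fu : dotp f u = 0 by rewrite dotpC.
have fv : dotp f (u + (r / 2) *: f) != 0.
  by rewrite !dotpE fu add0r mulf_neq0 // gt_eqF //; lra.
apply: indepC.
apply: (indepP _ _ f (u - (dotp u u / dotp (u + (r/2) *: f) f) *: f)) => //.
by rewrite !dotpE fu mulr0 subr0.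
Qed.

(** The pencil of one hyperplane through o serves any other, normal to u2: a third one is added, and
    the three pencils are compared by [three_chords] along the pairwise common directions. *)
Lemma adapted_from_exists o u : I o -> h u < dotp o u ->
  exists tau, adapted_from tau o.
Proof.
move=> Io ou; have u0 := separator_neq0 H _ _ ou.
have [tau1 pt1 a1] := hyperplane_pencil n2 H _ _ Io ou.
exists tau1; split=> // u2 x ou2 Bx xu2.
have [u2u|[k uE]] := indep_or_collinear u u2 u0; last first.
  have k0 : k != 0.
    apply: contraTneq (separator_neq0 H _ _ ou2) => k0.
    by rewrite uE k0 scale0r eqxx.
  apply: a1 => //; apply: (mulfI k0).
  by rewrite -!dotpZr -uE.
(* The third normal u + s f is independent of u and u2, and s is small enough for its hyperplane to
   miss L. *)
have [f [f0 uf u2f]] := exists_orthogonal2 u u2 n2.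
have [r r0 rP] := separator_open o u f ou.
pose s := r / 2; have s0 : s != 0 by rewrite gt_eqF // /s; lra.
have ou3 : h (u + s *: f) < dotp o (u + s *: f).
  by apply: rP; rewrite /s gtr0_norm; lra.
clearbody s.
have [tau2 pt2 a2] := hyperplane_pencil n2 H _ _ Io ou2.
have [tau3 pt3 a3] := hyperplane_pencil n2 H _ _ Io ou3.
have ff : dotp f f != 0 by rewrite dotp_eq0.
have [g1 [ug1 u2g1 fg1]] := indep_dual _ _ (indepC _ _ u2u).
have [g2 [u2g2 ug2 fg2]] := indep_dual _ _ u2u.
have {}fg1 := fg1 f uf u2f; have {}fg2 := fg2 f u2f uf.
(* The directions e1, g2 and f are common to the hyperplanes 2 and 3, 1 and 3, 1 and 2 respectively;
   the multiple of f in e1 makes it orthogonal to the third normal. *)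
pose e1 := g1 - (s * dotp f f)^-1 *: f.
have E (g : 'rV[R]_n) : dotp g (u + s *: f) = dotp u g + s * dotp f g.
  by rewrite !dotpE !(dotpC g).
have e1u : dotp e1 u = 1.
  by rewrite /e1 dotpBl dotpZl (dotpC g1) ug1 dotpC uf mulr0 subr0.
have e1u2 : dotp e1 u2 = 0.
  by rewrite /e1 dotpBl dotpZl (dotpC g1) u2g1 dotpC u2f mulr0 subr0.
have e1u3 : dotp e1 (u + s *: f) = 0.
  by rewrite E /e1 !dotpBr !dotpZr ug1 uf fg1; field; rewrite s0 ff.
have g2u : dotp g2 u = 0 by rewrite dotpC.
have g2u2 : dotp g2 u2 = 1 by rewrite dotpC.
have g2u3 : dotp g2 (u + s *: f) = 0 by rewrite E ug2 fg2 mulr0 addr0.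
have fu : dotp f u = 0 by rewrite dotpC.
have fu2 : dotp f u2 = 0 by rewrite dotpC.
have fu3 : dotp f (u + s *: f) != 0 by rewrite E uf add0r mulf_neq0.
clearbody e1.
have eg : indep e1 g2 by apply: (indepP _ _ u u2); rewrite dotpC ?e1u ?g2u2 ?g2u.
have ef : indep e1 f by apply: (indepP _ _ u (u + s *: f)); rewrite dotpC ?e1u.
have gf : indep g2 f by apply: (indepP _ _ u2 (u + s *: f)); rewrite dotpC ?g2u2.
have [k1 [b1 [k1_gt0 c1]]] := chord_exists H _ _ Io (indep_neq0l eg).
have [k2 [b2 [k2_gt0 c2]]] := chord_exists H _ _ Io (indep_neq0l gf).
have [k3 [b3 [k3_gt0 c3]]] := chord_exists H _ _ Io f0.
have Z k d v : dotp d v = 0 -> dotp (k *: d) v = 0.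
  by move=> dv; rewrite dotpZl dv mulr0.
have ch tau v d b : (forall x, B x -> dotp x v = dotp o v -> adapted h x (tau x)) ->
    chord o d b (B := B) -> dotp d v = 0 -> adapted_chord tau o d b (h := h).
  move=> at_ [_ B1 B2] dv; split; apply: at_ => //; rewrite !dotpE dv.
    by rewrite addr0.
  by rewrite mulr0 subr0.
have k1n : k1 != 0 by rewrite gt_eqF.
have k2n : k2 != 0 by rewrite gt_eqF.
have k3n : k3 != 0 by rewrite gt_eqF.
have [b1_gt0 _ _] := c1; have [b2_gt0 _ _] := c2; have [b3_gt0 _ _] := c3.
have [|c c0 cE] := three_chords n2 H _ _ _ _ _ _ _ _ _ _ _ _ _
  b1_gt0 b2_gt0 b3_gt0 (indep_scale _ _ _ _ k1n k2n eg)
  (indep_scale _ _ _ _ k1n k3n ef) (indep_scale _ _ _ _ k2n k3n gf)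
  ou ou2 ou3 (Z _ _ _ g2u) (Z _ _ _ fu) (Z _ _ _ e1u2) (Z _ _ _ fu2)
  (Z _ _ _ e1u3) (Z _ _ _ g2u3) _ pt1 pt2 pt3
  (ch _ _ _ _ a1 c2 (Z _ _ _ g2u)) (ch _ _ _ _ a1 c3 (Z _ _ _ fu))
  (ch _ _ _ _ a2 c1 (Z _ _ _ e1u2)) (ch _ _ _ _ a2 c3 (Z _ _ _ fu2))
  (ch _ _ _ _ a3 c1 (Z _ _ _ e1u3)) (ch _ _ _ _ a3 c2 (Z _ _ _ g2u3)).
  by right; rewrite !dotpZl e1u g2u2 !mulf_neq0.
apply: (adapted_scale _ (tau2 x) _ c^-1); first by rewrite invr_gt0.
  exact: a2.
by move=> v; rewrite cE mulKf // gt_eqF.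
Qed.

(** A pencil valid from o' exists; on the shared hyperplane it and tau are both adapted, so
    uniqueness makes them proportional. *)
Lemma adapted_from_hyperplane tau o o' u : I o -> I o' -> h u < dotp o u ->
  dotp o' u = dotp o u -> adapted_from tau o -> adapted_from tau o'.
Proof.
move=> Io Io' ou o'u [pt a]; have [tau' [pt' a']] : exists tau', adapted_from tau' o'.
  by apply: (adapted_from_exists _ u) => //; rewrite o'u.
have [||c c0 cE] := hyperplane_pencil_unique n2 H _ _ tau' tau Io ou pt' pt.
- by move=> x Bx xu; apply: (a' u) => //; rewrite o'u.
- by move=> x Bx xu; apply: (a u).
split=> // v x o'v Bx xv; apply: adapted_scale (c0) (a' v x o'v Bx xv) _.
exact: cE.
Qed.

(** The passage from o to o + t f goes through o1, which shares with o the hyperplane normal to v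
    and with o + t f the one normal to u. The bound on t keeps o1 in I and its second hyperplane off
    L. *)
Lemma adapted_from_local o u f : I o -> h u < dotp o u -> exists2 r, 0 < r &
  forall t, `|t| < r -> I (o + t *: f) ->
    forall tau, adapted_from tau o <-> adapted_from tau (o + t *: f).
Proof.
move=> Io ou; have [v ov uv] := separator_indep _ _ ou.
have [a [ua va _]] := indep_dual _ _ uv.
have [r0 r0_gt0 r0P] := inner_open _ _ _ H o a Io.
pose c := `|dotp f u| + 1; have c0 : 0 < c by rewrite ltr_wpDl.
pose g := Num.min r0 (dotp o u - h u).
have g0 : 0 < g by rewrite lt_min r0_gt0 subr_gt0.
exists (g / c); first by rewrite divr_gt0.
move=> t; rewrite ltr_pdivlMr // => tc It tau.
have tg : `|t * dotp f u| < g.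
  by apply: le_lt_trans tc; rewrite normrM ler_wpM2l // /c lerDl.
pose o1 := o + (t * dotp f u) *: a.
have Io1 : I o1 by apply: r0P; apply: lt_le_trans tg _; rewrite ge_min lexx.
have o1v : dotp o1 v = dotp o v by rewrite /o1 !dotpE (dotpC a) va mulr0 addr0.
have o1u : dotp o1 u = dotp (o + t *: f) u.
  by rewrite /o1 !dotpE (dotpC a) ua mulr1.
have uo1 : h u < dotp o1 u.
  have : `|t * dotp f u| < dotp o u - h u.
    by apply: lt_le_trans tg _; rewrite ge_min lexx orbT.
  by rewrite ltr_norml o1u !dotpE => /andP[]; lra.
split=> [/(adapted_from_hyperplane _ _ _ _ Io Io1 ov o1v)|].
  by apply: adapted_from_hyperplane Io1 It uo1 _.
move=> /(adapted_from_hyperplane _ _ _ u It Io1); rewrite -o1u => /(_ uo1 erefl).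
by apply: (adapted_from_hyperplane _ _ _ v) => //; rewrite o1v.
Qed.

(** The cap cut from I by [h u < dotp o u] is convex, so the local equivalence propagates along the
    segment from o to o'. *)
Lemma adapted_from_cap tau o o' u : I o -> I o' -> h u < dotp o u ->
  h u < dotp o' u -> adapted_from tau o -> adapted_from tau o'.
Proof.
move=> Io Io' ou o'u a.
pose p t := (1 - t) *: o + t *: o'.
have pE t t' : p t' = p t + (t' - t) *: (o' - o).
  rewrite /p scalerBr scalerBl !scalerBl !scale1r.
  by apply/rowP => i; rewrite !mxE; ring.
suff : adapted_from tau (p 1) by rewrite /p subrr scale0r add0r scale1r.
apply: (unit_interval_ind (fun t => adapted_from tau (p t))).
  by rewrite /p subr0 scale1r scale0r addr0.
move=> t t01; have It : I (p t) by exact: (inner_convex _ _ _ H).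
have [|r r0 rP] := adapted_from_local (p t) u (o' - o) It.
  move: t01 => /andP[t0 t1]; rewrite /p !dotpE.
  have m0 : h u < Num.min (dotp o u) (dotp o' u) by rewrite lt_min ou.
  apply: lt_le_trans m0 _; set m := Num.min _ _.
  have : 0 <= (1 - t) * (dotp o u - m).
    by rewrite mulr_ge0 ?subr_ge0 // /m ge_min lexx.
  have : 0 <= t * (dotp o' u - m).
    by rewrite mulr_ge0 ?subr_ge0 // /m ge_min lexx orbT.
  lra.
exists r => // t' t'01 tt'; rewrite (pE t t'); apply: rP => //.
by rewrite -pE; exact: (inner_convex _ _ _ H).
Qed.

Lemma cap_neq0 u : u != 0 -> exists2 o, I o & h u < dotp o u.
Proof.
move=> u0; have [p [Ip pu _]] := inner_contact _ _ _ H u.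
have [r r0 rP] := inner_open _ _ _ H p u Ip.
exists (p + (r / 2) *: u); first by apply: rP; rewrite gtr0_norm; lra.
by rewrite !dotpE pu ltrDl mulr_gt0 ?dotp_gt0 // divr_gt0.
Qed.

(** The normal moves along the segment from u0 to u1, which avoids 0 by independence; caps of nearby
    normals share a point q, which transfers the property from one to the other. *)
Lemma adapted_from_indep tau u0 u1 : indep u0 u1 ->
  (forall o, I o -> h u0 < dotp o u0 -> adapted_from tau o) ->
  (forall o, I o -> h u1 < dotp o u1 -> adapted_from tau o).
Proof.
move=> u01 a0; pose p t := (1 - t) *: u0 + t *: u1.
have pE t t' : p t' = p t + (t' - t) *: (u1 - u0).
  rewrite /p scalerBr scalerBl !scalerBl !scale1r.
  by apply/rowP => i; rewrite !mxE; ring.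
suff : forall o, I o -> h (p 1) < dotp o (p 1) -> adapted_from tau o.
  by rewrite /p subrr scale0r add0r scale1r.
apply: (unit_interval_ind (fun t =>
  forall o, I o -> h (p t) < dotp o (p t) -> adapted_from tau o)).
  by rewrite /p subr0 scale1r scale0r addr0.
move=> t _; have pt0 : p t != 0.
  by apply/eqP => /u01[]; lra.
have [q Iq qu] := cap_neq0 _ pt0.
have [r r0 rP] := separator_open q (p t) (u1 - u0) qu.
exists r => // t' _ /rP; rewrite -pE => qu'.
by split=> a o' Io' o'u; [apply: (adapted_from_cap _ q o' (p t'))
  |apply: (adapted_from_cap _ q o' (p t))] => //; apply: a.
Qed.

Lemma adapted_from_everywhere : exists tau, forall o u, I o ->
  h u < dotp o u -> adapted_from tau o.
Proof.
have [u0 [u0_neq0 _ _]] := @exists_orthogonal2 R n 0 0 n2.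
have [q Iq o0u] := cap_neq0 _ u0_neq0.
have [tau a] := adapted_from_exists _ _ Iq o0u.
have a0 o : I o -> h u0 < dotp o u0 -> adapted_from tau o.
  by move=> Io ou; apply: (adapted_from_cap _ q o u0).
exists tau => o u Io ou.
have [uu0|[k uE]] := indep_or_collinear u0 u u0_neq0.
  by apply: (adapted_from_indep _ u0 u) => //; exact: indepC.
have [u2 o0u2 u02] := separator_indep _ _ o0u.
have k0 : k != 0.
  apply: contraTneq (separator_neq0 H _ _ ou) => k0.
  by rewrite uE k0 scale0r eqxx.
apply: (adapted_from_indep _ u2 u) => //.
  rewrite uE -[u2]scale1r; apply: indep_scale => //; exact: indepC.
exact: (adapted_from_indep _ u0 u2).
Qed.

Lemma norm_sqr_qform : exists2 f, qform f & forall v, h v ^+ 2 = f v.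
Proof.
have [tau aT] := adapted_from_everywhere.
(* The hyperplane normal to v through x touches L, so it is tilted: v + s w strictly separates x
   from L for s > 0, w being a separating direction at x. *)
have touch v : v != 0 -> exists2 x, dotp x v = h v &
    pencil tau /\ adapted h x (tau x).
  move=> v0; have [p [Ip pv pw]] := inner_contact _ _ _ H v.
  have [d [d0 vd _]] := exists_orthogonal2 v v n2.
  have [t t0 Bx] := ray_exit _ _ _ H p d Ip d0.
  set x := p + t *: d in Bx.
  have xv : dotp x v = h v by rewrite /x !dotpE pv (dotpC d) vd mulr0 addr0.
  clearbody x; exists x => //; have [w xw] := apex_separated _ _ _ H x Bx.
  have pxw : 0 < dotp x w - dotp p w.
    by rewrite subr_gt0; apply: le_lt_trans xw.
  have [r r0 rP] := inner_open _ _ _ H p v Ip.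
  pose c := `|dotp v w| + 1; have c0 : 0 < c by rewrite ltr_wpDl.
  pose k := Num.min r ((dotp x w - dotp p w) / c) / 2.
  have m0 : 0 < Num.min r ((dotp x w - dotp p w) / c).
    by rewrite lt_min r0 divr_gt0.
  have k0 : 0 < k by rewrite divr_gt0.
  have kr : k < r.
    have : Num.min r ((dotp x w - dotp p w) / c) <= r by rewrite ge_min lexx.
    by rewrite /k; lra.
  have kc : k * c < dotp x w - dotp p w.
    rewrite -ltr_pdivlMr //.
    have : Num.min r ((dotp x w - dotp p w) / c) <= (dotp x w - dotp p w) / c.
      by rewrite ge_min lexx orbT.
    by rewrite /k; lra.
  have D0 : 0 < dotp x w - dotp p w - k * dotp v w.
    by have := ler_norm (dotp v w); move: kc; rewrite /c; nra.
  (* This s puts the interior point p + k v on the tilted hyperplane through x; k is small enough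
     for that point to be in I and for the denominator to be positive. *)
  pose s := k * dotp v v / (dotp x w - dotp p w - k * dotp v w).
  have s0 : 0 < s by rewrite divr_gt0 // mulr_gt0 // dotp_gt0.
  have sE : s * (dotp x w - dotp p w - k * dotp v w) = k * dotp v v.
    by rewrite divfK // gt_eqF.
  have Io : I (p + k *: v) by apply: rP; rewrite gtr0_norm.
  have ou : dotp x (v + s *: w) = dotp (p + k *: v) (v + s *: w).
    rewrite !dotpE xv pv; nra.
  have hu : h (v + s *: w) < dotp x (v + s *: w).
    apply: le_lt_trans (normD _ _ _ H _ _) _.
    by rewrite (normZ _ _ _ H) gtr0_norm // dotpDr dotpZr xv ltrD2l ltr_pM2l.
  rewrite ou in hu; have [pt a] := aT _ _ Io hu.
  by split => //; exact: a hu Bx ou.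
have [v1 [v1_neq0 _ _]] := @exists_orthogonal2 R n 0 0 n2.
have [x1 _ [pt a1]] := touch _ v1_neq0.
have [f [m [s [qf tE]]]] := pt.
have hN v : h (- v) = h v by rewrite -scaleN1r (normZ _ _ _ H) normrN1 mul1r.
have rel v : v != 0 -> f v + dotp m v * h v + s * h v ^+ 2 = 0.
  move=> v0; have [x xv [_ a]] := touch _ v0; have := a v.
  by rewrite xv subrr sgr0 => /eqP; rewrite sgr_eq0 tE xv => /eqP.
(* Comparing the relation at v and - v removes the odd term m h. *)
have f0 v : v != 0 -> f v = - s * h v ^+ 2.
  move=> v0; have := rel _ v0; have : - v != 0 by rewrite oppr_eq0.
  move=> /rel; have := qform_scale f (-1) v qf.
  by rewrite scaleN1r sqrrN expr1n mul1r hN dotpNr => ->; lra.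
have [v [v0 xv _]] := exists_orthogonal2 x1 x1 n2.
have s0 : s < 0.
  have := adapted_gt0 H _ _ v a1 v0 xv.
  rewrite tE xv mulr0 addr0 expr0n mulr0 addr0 f0 //.
  by have := norm_gt0 _ _ _ H v v0; nra.
exists (fun v => (- s)^-1 * f v); first exact: qformZ.
move=> w; have [->|w0] := eqVneq w 0.
  have := qform_scale f 0 0 qf; rewrite scale0r (norm0 H) => ->.
  by rewrite !expr0n /= mul0r mulr0.
by rewrite f0 // mulKf // oppr_eq0 lt_eqF.
Qed.

End Propagation.

(** * Positive forms and ellipsoidal cones *)

Section PositiveForms.
Context {R : realType}.

Lemma dotp_row_mx {m n : nat} (a c : 'rV[R]_m) (b d : 'rV[R]_n) :
  dotp (row_mx a b) (row_mx c d) = dotp a c + dotp b d.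
Proof. by rewrite !dotp_mx tr_row_mx mul_row_col mxE. Qed.

Lemma qform_mulmx {m n : nat} (f : 'rV[R]_n -> R) (J : 'M[R]_(m, n)) :
  qform f -> qform (fun w => f (w *m J)).
Proof.
by move=> [S fS]; exists (J *m S *m J^T) => w; rewrite fS !mulmxA [RHS]dotp_mulr trmxK.
Qed.

(** Induction by completing the square in the first coordinate: g w is the minimum of f over the
    line through w J in direction e, hence again positive. *)
Lemma positive_form_sum_squares {n : nat} (f : 'rV[R]_n -> R) : qform f ->
  (forall v, v != 0 -> 0 < f v) ->
  exists A : 'M[R]_n, forall v, f v = dotp (v *m A) (v *m A).
Proof.
elim: n f => [|n IHn] f qf f0.
  by exists 0 => v; rewrite [v]thinmx0 mul0mx dotp0l; case: qf => S ->; rewrite dotp0r.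
change (n.+1) with (1 + n)%N in f, qf, f0 |- *.
pose J : 'M[R]_(n, 1 + n) := row_mx 0 1%:M.
pose e : 'rV[R]_(1 + n) := row_mx 1%:M 0.
have JE w : w *m J = row_mx 0 w by rewrite mul_mx_row mulmx0 mulmx1.
have e0 : e != 0.
  by rewrite row_mx_eq0 negb_and -(scalemx1 1) scale1r matrix_nonzero1.
have fe := f0 _ e0.
have [S fS] := qf.
pose m : 'rV[R]_(1 + n) := e *m S + e *m S^T.
have fE a w : f (a *: e + w) = a ^+ 2 * f e + a * dotp m w + f w.
  rewrite !fS mulmxDl -scalemxAl !dotpE (dotp_mulr w e S) (dotpC w).
  by ring.
pose c := (2 * f e)^-1.
pose g w := f (w *m J) - (c * dotp m (w *m J)) * dotp m (w *m J) / 2.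
have gE w : g w = f (- (c * dotp m (w *m J)) *: e + w *m J).
  rewrite fE /g /c; field; exact: lt0r_neq0.
have [||B gB] := IHn g.
- apply: qformB; first exact: qform_mulmx.
  apply: (qform_ext (fun w => c / 2 * (dotp (m *m J^T) w * dotp (m *m J^T) w))).
    exact/qformZ/qform_mul.
  by move=> w; rewrite dotp_mulr trmxK; ring.
- move=> w w0; rewrite gE f0 // JE /e scale_row_mx add_row_mx addr0 scaler0 add0r.
  by rewrite row_mx_eq0 negb_and w0 orbT.
pose q : 'rV[R]_(1 + n) := (Num.sqrt (f e) * c) *: m.
exists (row_mx q^T (col_mx 0 B)) => v.
pose a := lsubmx v 0 0; pose w := rsubmx v.
have vE : v = a *: e + w *m J.
  rewrite JE /e scale_row_mx add_row_mx addr0 scaler0 add0r /a scalemx1.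
  by rewrite -mx11_scalar hsubmxK.
have vq : v *m q^T = (dotp v q)%:M by rewrite dotp_mx -mx11_scalar.
have vB : v *m col_mx 0 B = w *m B.
  by rewrite -[v]hsubmxK mul_row_col mulmx0 add0r.
rewrite mul_mx_row vq vB dotp_row_mx -gB.
have -> : dotp (dotp v q)%:M (dotp v q)%:M = dotp v q ^+ 2.
  by rewrite dotp_mx tr_scalar_mx -scalar_mxM mxE eqxx mulr1n.
have me : dotp m e = 2 * f e.
  by rewrite /m dotpDl (dotpC (e *m S^T)) -dotp_mulr -fS; ring.
have vm : dotp v m = a * dotp m e + dotp m (w *m J).
  by rewrite {1}vE dotpDl dotpZl (dotpC e m) (dotpC (w *m J) m).
have -> : dotp v q ^+ 2 = f e * (c * (a * dotp m e + dotp m (w *m J))) ^+ 2.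
  by rewrite /q dotpZr vm !exprMn sqr_sqrtr ?ltW //; ring.
rewrite {1}vE fE me /g /c; field; exact: lt0r_neq0.
Qed.

(** Cauchy-Schwarz, from the nonnegative square of N z - w with N the norm of w. *)
Lemma dotp_le_sqrt {n : nat} (z w : 'rV[R]_n) : dotp z z <= 1 ->
  dotp z w <= Num.sqrt (dotp w w).
Proof.
move=> z1; have [->|w0] := eqVneq w 0; first by rewrite dotp0r sqrtr_ge0.
have N0 : 0 < Num.sqrt (dotp w w) by rewrite sqrtr_gt0 dotp_gt0.
have NN : Num.sqrt (dotp w w) ^+ 2 = dotp w w by rewrite sqr_sqrtr // dotp_ge0.
have := dotp_ge0 (Num.sqrt (dotp w w) *: z - w).
rewrite !dotpE (dotpC w z); set N := Num.sqrt _ in N0 NN *; rewrite -NN.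
by nra.
Qed.

End PositiveForms.

Section EllipsoidalCones.
Context {R : realType} {n : nat}.
Implicit Types (u v w x y : 'rV[R]_n).

Lemma convex_set_comb (L : set 'rV[R]_n) x y (t : R) : convex_set L ->
  L x -> L y -> 0 <= t <= 1 -> L ((1 - t) *: x + t *: y).
Proof.
move=> cL Lx Ly /andP[t0 t1].
have := cL y x (Itv01 t0 t1); rewrite !inE => /(_ Ly Lx).
by rewrite addrC.
Qed.

(** Central projection from x matches L with the ellipsoid c + z A by positive factors, so the
    suprema of u over both, relative to x, have the same sign. For the ellipsoid the supremum is N u
    - (x - c).u with N u the norm of u A^T; multiplying the statements for u and - u gives the form
    N^2 - ((x - c).u)^2. *)
Lemma ellipsoidal_cone_qform (L : set 'rV[R]_n) (h : 'rV[R]_n -> R) x :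
  (2 < n)%N -> convex_set L -> ~ L x ->
  (forall u, h (- u) = h u) ->
  (forall u y, L y -> dotp y u <= h u) ->
  (forall u, exists2 p, L p & dotp p u = h u) ->
  ellipsoidal (gen_cone L x) -> exists2 f, qform f & adapted h x f.
Proof.
move=> n2 cL xL hN hmax hex [_ [a [b [a0 ->]]] [c [A [rA /seteqP[CE EC]]]]].
have [A' AA'] := row_freeP rA.
have inE' z : dotp z z <= 1 -> exists l y, [/\ 0 <= l, L y,
    c + z *m A = x + l *: (y - x) & dotp a (c + z *m A) = b].
  move=> z1; have [|/= [y Ly [l l0 <-]] ab] := EC (c + z *m A); first by exists z.
  by exists l, y.
have inC l y : L y -> 0 <= l -> dotp a (x + l *: (y - x)) = b ->
    exists2 z, dotp z z <= 1 & c + z *m A = x + l *: (y - x).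
  move=> Ly l0 ab; have [|z z1 zE] := CE (x + l *: (y - x)); last by exists z.
  by split => //; exists y => //; exists l.
have [l0 [y0 [l0_ge0 Ly0 cE ab]]] := inE' 0 (eq_ind_r (fun s => s <= 1) ler01 (dotp0l 0)).
rewrite mul0mx addr0 in cE ab.
have yx y : L y -> y - x != 0.
  by move=> Ly; rewrite subr_eq0; apply/eqP => yx; apply: xL; rewrite -yx.
(* Otherwise the section of the cone would contain the ray c + t (y - x). *)
have transversal y : L y -> dotp a (y - x) != 0.
  move=> Ly; apply/eqP => ay.
  have ray (t : R) : 0 < t -> exists2 z, dotp z z <= 1 & t *: (y - x) = z *m A.
    move=> t0; pose l := l0 + t; have lt : 0 < l by rewrite ltr_wpDl.
    have t01 : 0 <= t / l <= 1.
      by rewrite (divr_ge0 (ltW t0) (ltW lt)) ler_pdivrMr // mul1r lerDr.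
    have E : x + l *: ((1 - t / l) *: y0 + (t / l) *: y - x) = c + t *: (y - x).
      rewrite cE; apply/rowP => i; rewrite !mxE /l; field.
      by rewrite gt_eqF.
    have [|z z1 zE] := inC l _ (convex_set_comb _ _ _ _ cL Ly0 Ly t01) (ltW lt).
      by rewrite E dotpDr dotpZr ay mulr0 addr0.
    by exists z => //; apply: (addrI c); rewrite zE E.
  have [z1 z1_le z1E] := ray 1 ltr01; rewrite scale1r in z1E.
  have zz : 0 < dotp z1 z1.
    apply: dotp_gt0; apply: contraNneq (yx _ Ly) => z0.
    by rewrite z1E z0 mul0mx.
  pose t := 1 + (dotp z1 z1)^-1; have t0 : 0 < t by rewrite addr_gt0 ?invr_gt0.
  have [z z_le zE] := ray _ t0.
  have zz1 : z = t *: z1.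
    by rewrite -[z]mulmx1 -AA' mulmxA -zE z1E scalemxAl -mulmxA AA' mulmx1.
  move: z_le; rewrite zz1 dotpZl dotpZr; have : t * dotp z1 z1 = dotp z1 z1 + 1.
    by rewrite /t mulrDl mul1r mulVf ?gt_eqF.
  have t1 : 1 < t by rewrite ltrDl invr_gt0.
  by move=> ->; nra.
have bE : b - dotp a x = l0 * dotp a (y0 - x).
  by rewrite -ab cE dotpDr dotpZr; ring.
have n1 : (0 < n.-1)%N by rewrite -subn1 subn_gt0; apply: ltn_trans n2.
(* If x were on the section hyperplane, the section would be the single point x; but n - 1 > 0, so a
   unit z gives a second point. *)
have b0 : b - dotp a x != 0.
  apply/eqP => bx; pose z : 'rV[R]_n.-1 := delta_mx 0 (Ordinal n1).
  have xE l y : 0 <= l -> L y -> dotp a (x + l *: (y - x)) = b -> l = 0.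
    move=> _ Ly; rewrite dotpDr dotpZr => E.
    have /eqP : l * dotp a (y - x) = 0 by rewrite -bx -E; ring.
    by rewrite mulf_eq0 (negPf (transversal _ Ly)) orbF => /eqP.
  have cx : c = x by rewrite cE (xE _ _ l0_ge0 Ly0) -?cE // scale0r addr0.
  have z1 : dotp z z = 1.
    rewrite /dotp (bigD1 (Ordinal n1)) //= big1 ?addr0 ?mxE ?eqxx ?mulr1 //.
    by move=> i ni; rewrite !mxE (negPf ni) mulr0.
  have [|l [y [l_ge0 Ly zE ab']]] := inE' z; first by rewrite z1.
  have zA : z *m A = 0.
    apply: (addrI c); rewrite addr0 zE cx (xE _ _ l_ge0 Ly) ?scale0r ?addr0 //.
    by rewrite -zE.
  have : z = 0 by rewrite -[z]mulmx1 -AA' mulmxA zA mul0mx.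
  by move=> z0; move: z1; rewrite z0 dotp0l => /esym/eqP; rewrite oner_eq0.
(* If y and y0 were on opposite sides of the parallel hyperplane through x, their segment would meet
   it in a point of L, against [transversal]. *)
have side y : L y -> 0 < (b - dotp a x) / dotp a (y - x).
  move=> Ly; have s0 : 0 < (b - dotp a x) / dotp a (y0 - x).
    rewrite bE mulfK ?transversal // lt_neqAle l0_ge0 andbT eq_sym.
    by apply: contraNneq b0 => l00; rewrite bE l00 mul0r.
  have [//|neg] := ltP 0 ((b - dotp a x) / dotp a (y - x)).
  have p0 := transversal _ Ly; have q0 := transversal _ Ly0.
  move: neg s0 p0 q0.
  have [p pE] : exists p, dotp a (y - x) = p by eexists.
  have [q qE] : exists q, dotp a (y0 - x) = q by eexists.
  rewrite pE qE => neg s0 p0 q0.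
  have pq : p * q < 0.
    have b2 : 0 < (b - dotp a x) ^+ 2 by rewrite lt_neqAle eq_sym sqrf_eq0 b0 sqr_ge0.
    have neg' : (b - dotp a x) / p < 0.
      by rewrite lt_neqAle neg andbT mulf_neq0 // invr_eq0.
    have E : ((b - dotp a x) / p) * ((b - dotp a x) / q) * (p * q)
      = (b - dotp a x) ^+ 2 by field; rewrite p0 q0.
    rewrite -(nmulr_rgt0 _ (_ : ((b - dotp a x) / p) * ((b - dotp a x) / q) < 0)).
      by rewrite E.
    by rewrite nmulr_rlt0.
  have D0 : q - p != 0.
    apply/eqP => D0; have qp : q = p by lra.
    by move: pq; rewrite qp -expr2 ltNge sqr_ge0.
  have t01 : 0 <= q / (q - p) <= 1.
    have E : q / (q - p) = (q ^+ 2 - p * q) / (q - p) ^+ 2 by field.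
    have E' : 1 - q / (q - p) = (p ^+ 2 - p * q) / (q - p) ^+ 2 by field.
    rewrite -[X in _ && X]subr_ge0 E' E.
    have := sqr_ge0 p; have := sqr_ge0 q => ? ?.
    by apply/andP; split; apply: divr_ge0; rewrite ?sqr_ge0 //; lra.
  have /negP[] := transversal _ (convex_set_comb _ _ _ _ cL Ly0 Ly t01).
  have -> : (1 - q / (q - p)) *: y0 + (q / (q - p)) *: y - x =
      (1 - q / (q - p)) *: (y0 - x) + (q / (q - p)) *: (y - x).
    by apply/rowP => i; rewrite !mxE; ring.
  by rewrite dotpDr !dotpZr pE qE; apply/eqP; field.
have shadow y : L y -> exists l z, [/\ 0 < l, dotp z z <= 1 &
    c + z *m A = x + l *: (y - x)].
  move=> Ly; have s0 := side _ Ly; exists ((b - dotp a x) / dotp a (y - x)).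
  have [|z z1 zE] := inC _ _ Ly (ltW s0); last by exists z.
  by rewrite dotpDr dotpZr divfK ?transversal //; ring.
have lift z : dotp z z <= 1 -> exists l y, [/\ 0 < l, L y &
    c + z *m A = x + l *: (y - x)].
  move=> /inE'[l [y [l_ge0 Ly zE ab']]]; exists l, y; split => //.
  rewrite lt_neqAle l_ge0 andbT eq_sym; apply: contraNneq b0 => l00.
  by rewrite -ab' zE l00 scale0r addr0 subrr.
pose N u := Num.sqrt (dotp (u *m A^T) (u *m A^T)).
have sgN u : Num.sg (N u - dotp (x - c) u) = Num.sg (h u - dotp x u).
  (* The maximizer z of u on the ellipsoid is lifted to L, bounding the left side above; the contact
     point of L is projected to the ellipsoid, bounding it below. *)
  have [l [y [l_gt0 Ly E1]]] : exists l y, [/\ 0 < l, L y &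
      N u - dotp (x - c) u = l * (dotp y u - dotp x u)].
    have [z z1 zN] : exists2 z, dotp z z <= 1 & dotp z (u *m A^T) = N u.
      have [w0|w0] := eqVneq (u *m A^T) 0.
        by exists 0; rewrite ?dotp0l ?ler01 // /N w0 dotp0l sqrtr0.
      have N0 : 0 < N u by rewrite sqrtr_gt0 dotp_gt0.
      have NN : dotp (u *m A^T) (u *m A^T) = N u ^+ 2.
        by rewrite sqr_sqrtr // dotp_ge0.
      by exists ((N u)^-1 *: (u *m A^T)); rewrite !dotpE NN;
        [rewrite le_eqVlt; apply/orP; left; apply/eqP|]; field; rewrite gt_eqF.
    have [l [y [l_gt0 Ly E]]] := lift _ z1; exists l, y; split => //.
    have := congr1 (fun p => dotp p u) E; rewrite /= !dotpE dotp_mulr zN.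
    by move=> E'; lra.
  have [p Lp pu] := hex u; have [l' [z [l'_gt0 z1 E]]] := shadow _ Lp.
  have E2 : l' * (h u - dotp x u) <= N u - dotp (x - c) u.
    have := congr1 (fun p => dotp p u) E; rewrite /= !dotpE dotp_mulr pu.
    have : dotp z (u *m A^T) <= N u by exact: dotp_le_sqrt.
    by lra.
  have yh := hmax u y Ly.
  have [hx|hx|hx] := ltgtP (h u) (dotp x u).
  - by rewrite [RHS]ltr0_sg ?subr_lt0 // ltr0_sg // E1; nra.
  - by rewrite [RHS]gtr0_sg ?subr_gt0 // gtr0_sg //; nra.
  - suff -> : N u - dotp (x - c) u = 0 by rewrite hx subrr.
    by apply/eqP; rewrite eq_le; apply/andP; split; [rewrite E1|]; nra.
exists (fun u => dotp (u *m A^T) (u *m A^T) - dotp (x - c) u * dotp (x - c) u).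
  apply: qformB; last exact: qform_mul.
  by exists (A^T *m A) => u; rewrite mulmxA [RHS]dotp_mulr.
move=> u; have NE : dotp (u *m A^T) (u *m A^T) = N u ^+ 2.
  by rewrite /N sqr_sqrtr // dotp_ge0.
have NN : N (- u) = N u by rewrite /N mulNmx dotpNl dotpNr opprK.
have := sgN (- u); rewrite NN hN !dotpNr !opprK => sN'.
rewrite NE -expr2 !subr_sqr !sgrM sgN; congr (_ * _).
exact: sN'.
Qed.

End EllipsoidalCones.

(** * Convex bodies *)

Section ConvexBodies.
Context {R : realType} {n : nat}.
Implicit Types (K L : set 'rV[R]_n) (d o u v w x y : 'rV[R]_n).

Lemma dotp_continuous {T : topologicalType} (f g : T -> 'rV[R]_n) :
  continuous f -> continuous g -> continuous (fun t => dotp (f t) (g t)).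
Proof.
have entry (k : T -> 'rV[R]_n) i : continuous k -> continuous (fun t => k t ord0 i).
  move=> ck t; apply: (@continuous_comp _ _ _ k (fun M : 'rV[R]_n => M ord0 i)).
    exact: ck.
  exact: (@coord_continuous R 1 n ord0 i (k t)).
move=> cf cg; apply: (@continuous_big R^o 'I_n) => [|i _ t].
  exact: add_continuous.
by apply: continuousM; exact: entry.
Qed.

Lemma interior_normP K x :
  K° x <-> exists2 e : R, 0 < e & forall y, `|y - x| < e -> K y.
Proof.
split=> [/nbhs_ballP[e /= e0 eK]|[e e0 eK]].
  by exists e => // y yx; apply: eK; rewrite -ball_normE /= distrC.
by apply/nbhs_ballP; exists e => //= y; rewrite -ball_normE /= distrC => /eK.
Qed.

Lemma interior_convex K x y (t : R) : convex_set K -> K° x -> K° y ->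
  0 <= t <= 1 -> K° ((1 - t) *: x + t *: y).
Proof.
move=> cK /interior_normP[e e0 eK] /interior_normP[e' e'0 e'K] t01.
apply/interior_normP; exists (Num.min e e'); first by rewrite lt_min e0.
move=> z; set w := z - _; rewrite lt_min => /andP[we we'].
have -> : z = (1 - t) *: (x + w) + t *: (y + w).
  by rewrite /w; apply/rowP => i; rewrite !mxE; ring.
apply: convex_set_comb => //; [apply: eK|apply: e'K].
  by rewrite addrC addKr.
by rewrite addrC addKr.
Qed.

Lemma interior_line K o d : K° o ->
  exists2 r : R, 0 < r & forall t, `|t| < r -> K° (o + t *: d).
Proof.
move=> /(open_interior K)/interior_normP[e e0 eK].
have c0 : 0 < `|d| + 1 by rewrite ltr_wpDl.
exists (e / (`|d| + 1)); first by rewrite divr_gt0.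
move=> t; rewrite ltr_pdivlMr // => te; apply: eK.
rewrite addrC addKr normrZ; apply: le_lt_trans te.
by rewrite ler_wpM2l // lerDl.
Qed.

(** The exit parameter is the supremum of the t >= 0 with o + t d in K, finite as K is bounded; at
    an interior point the ray would continue in K. *)
Lemma ray_boundary K o d : compact K -> K° o -> d != 0 ->
  exists2 t : R, 0 < t & boundary K (o + t *: d).
Proof.
move=> cK Ko d0; pose A := [set t : R | 0 <= t /\ K (o + t *: d)].
have nd : 0 < `|d| by rewrite normr_gt0.
have [r r0 rK] := interior_line _ _ d Ko.
have Ar : A (r / 2).
  split; first by rewrite ltW // divr_gt0.
  by apply: interior_subset; apply: rK; rewrite gtr0_norm; lra.
have [M _ MK] : exists2 M, 0 < M & forall y, K y -> `|y| <= M.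
  have [M [_ MP]] := compact_bounded cK.
  exists (`|M| + 1) => [|y Ky]; first by rewrite ltr_wpDl.
  by apply: (MP (`|M| + 1)) => //; have := ler_norm M; lra.
have hA : has_sup A.
  split; first by exists (r / 2).
  exists ((M + `|o|) / `|d|) => t [t0 Kt]; rewrite ler_pdivlMr //.
  rewrite -[t]ger0_norm // -normrZ -[_ *: _](addKr o) addrC.
  by apply: le_trans (ler_normB _ _) _; rewrite lerD2r MK.
pose s := sup A; have s0 : 0 < s.
  by apply: lt_le_trans (sup_upper_bound hA Ar); rewrite divr_gt0.
exists s => //; split.
  move=> V /nbhs_ballP[e /= e0 eV].
  have c0 : 0 < e / (`|d| + 1) by rewrite divr_gt0 // ltr_wpDl.
  have [t [t0 Kt] st] := sup_adherent c0 hA.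
  have ts : t <= s by exact: sup_upper_bound.
  exists (o + t *: d); split => //; apply: eV; rewrite -ball_normE /=.
  rewrite opprD addrACA subrr add0r -scalerBl normrZ ger0_norm ?subr_ge0 //.
  have : (s - t) * (`|d| + 1) < e.
    by rewrite -ltr_pdivlMr ?ltr_wpDl //; rewrite -/s in st; lra.
  by apply: le_lt_trans; rewrite ler_wpM2l ?subr_ge0 // lerDl.
move=> /(interior_line _ _ d)[e e0 eK].
have : A (s + e / 2).
  split; first by rewrite addr_ge0 // ltW // divr_gt0.
  rewrite scalerDl addrA; apply: interior_subset; apply: eK.
  by rewrite gtr0_norm; lra.
by move=> /(sup_upper_bound hA); rewrite -/s; lra.
Qed.

Lemma support_function_exists L : compact L -> L !=set0 ->
  exists h : 'rV[R]_n -> R, forall u,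
    (exists2 p, L p & dotp p u = h u) /\ (forall y, L y -> dotp y u <= h u).
Proof.
move=> cL L0; suff /choice[h hP] : forall u, exists k,
  (exists2 p, L p & dotp p u = k) /\ (forall y, L y -> dotp y u <= k) by exists h.
move=> u; have [|p pL pmax] := compact_EVT_max (f := fun y => dotp y u) L0 cL.
  apply: continuous_subspaceT; apply: (dotp_continuous id (fun=> u)) => x;
    [exact: cvg_id|exact: cst_continuous].
exists (dotp p u); split; first by exists p => //; rewrite -inE.
by move=> y Ly; apply: pmax; rewrite inE.
Qed.

(* u points from the nearest point of L to x. *)
Lemma convex_separation L x : compact L -> convex_set L -> L !=set0 -> ~ L x ->
  exists u, forall y, L y -> dotp y u < dotp x u.
Proof.
move=> cL cvL L0 xL.
have [|p] := compact_EVT_min (f := fun y => dotp (y - x) (y - x)) L0 cL.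
  apply: continuous_subspaceT.
  have cx : continuous (fun y => y - x).
    by move=> y; apply: continuousB; [exact: cvg_id|exact: cst_continuous].
  exact: (dotp_continuous (fun y => y - x) (fun y => y - x)).
rewrite inE => Lp pmin; exists (x - p) => y Ly.
have xp : 0 < dotp (x - p) (x - p).
  by apply: dotp_gt0; rewrite subr_eq0; apply/eqP => xp; apply: xL; rewrite xp.
suff : 0 <= dotp (y - p) (p - x).
  by move: xp; rewrite !dotpE (dotpC p x); lra.
set m := dotp _ _; rewrite leNgt; apply/negP => m0.
pose q := dotp (y - p) (y - p).
have near_p t : 0 <= t <= 1 -> 0 <= 2 * t * m + t ^+ 2 * q.
  move=> t01; have := pmin ((1 - t) *: p + t *: y).
  rewrite inE => /(_ (convex_set_comb _ _ _ _ cvL Lp Ly t01)).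
  have -> : (1 - t) *: p + t *: y - x = (p - x) + t *: (y - p).
    by apply/rowP => i; rewrite !mxE; ring.
  rewrite !(dotpDl (p - x)) !(dotpDr _ (t *: _)) !dotpZl !dotpZr.
  rewrite (dotpC (p - x) (y - p)) -/m -/q; lra.
have q1 : 0 <= 2 * m + q.
  by have := near_p 1; rewrite lexx ler01 expr1n mulr1 mul1r; exact.
have q0 : 0 < q by lra.
(* The value - m / q minimizes 2 t m + t^2 q, and the minimum is negative. *)
have t01 : 0 <= - m / q <= 1.
  apply/andP; split; first by rewrite divr_ge0 ?oppr_ge0 // ltW.
  by rewrite ler_pdivrMr // mul1r; lra.
have := near_p _ t01.
have -> : 2 * (- m / q) * m + (- m / q) ^+ 2 * q = - (m ^+ 2 / q).
  by field; rewrite gt_eqF.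
by rewrite oppr_ge0 leNgt divr_gt0 // lt_neqAle eq_sym sqrf_eq0 lt_eqF // sqr_ge0.
Qed.

End ConvexBodies.

(** * From the quadratic form h^2 to the ellipsoid *)

Theorem theorem1 (R : realType) (n : nat) (L K : set 'rV[R]_n)
    (hn : (3 <= n)%N)
    (hL : convex_body L) (hK : convex_body K)
    (hLK : L `<=` K°)
    (hLsym : o_symmetric L)
    (hcone : forall x : 'rV[R]_n, boundary K x -> ellipsoidal (gen_cone L x)) :
  ellipsoid L.
Proof.
have [cL cvL [y0 Ly0]] := hL; have [cK cvK _] := hK.
have L0 : L !=set0 by exists y0; exact: interior_subset.
have LN y : L y -> L (- y) by move=> Ly; rewrite hLsym; exists y.
have [h hP] := support_function_exists L cL L0.
have hmax u y : L y -> dotp y u <= h u by have [_] := hP u; apply.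
have hex u : exists2 p, L p & dotp p u = h u by have [] := hP u.
have hN u : h (- u) = h u.
  have le v : h (- v) <= h v.
    by have [p Lp <-] := hex (- v); rewrite dotpNr -dotpNl; exact/hmax/LN.
  by apply/eqP; rewrite eq_le le -{1}[u]opprK le.
have sep x : ~ L x -> exists u, h u < dotp x u.
  move=> xL; have [u uP] := convex_separation _ _ cL cvL L0 xL; exists u.
  by have [p Lp <-] := hex u; exact: uP.
have bL x : boundary K x -> ~ L x by move=> [_ xK] /hLK.
(* By symmetry both y0 + (r/2) v and - y0 + (r/2) v lie in L; adding their bounds gives r (v.v) <= 2
   h v. *)
have h_gt0 v : v != 0 -> 0 < h v.
  move=> v0; have [r r0 rL] := interior_line _ _ v Ly0.
  have r2 : `|r / 2| < r by rewrite gtr0_norm; lra.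
  have := hmax v _ (interior_subset (rL _ r2)).
  have := hmax v _ (LN _ (interior_subset (rL (- (r / 2)) _))).
  rewrite normrN => /(_ r2); have := dotp_gt0 _ v0; rewrite !dotpE; nra.
have hZp (k : R) v : 0 <= k -> h (k *: v) = k * h v.
  move=> k0; apply/eqP; rewrite eq_le; apply/andP; split.
    have [p Lp <-] := hex (k *: v); rewrite dotpZr ler_wpM2l //; exact: hmax.
  have [p Lp <-] := hex v; rewrite -dotpZr; exact: hmax.
have sys : apex_system h K° (boundary K).
  split.
  - exact: h_gt0.
  - move=> u v; have [p Lp <-] := hex (u + v).
    by rewrite dotpDr lerD ?hmax.
  - move=> k v; have [k0|k0] := leP 0 k; first by rewrite hZp // ger0_norm.
    by rewrite ltr0_norm // -hZp ?oppr_ge0 ?ltW // scaleNr hN.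
  - by move=> o d; exact: interior_line.
  - by move=> x y t Kx Ky; exact: interior_convex.
  - by move=> x Kx [].
  - move=> v; have [p Lp pv] := hex v; exists p; split => //; first exact: hLK.
    by move=> w; exact: hmax.
  - by move=> o d; exact: ray_boundary.
  - by move=> x /bL; exact: sep.
  - move=> x Bx; apply: (ellipsoidal_cone_qform L) => //; first exact: bL.
    exact: hcone.
have [f qf hf] := norm_sqr_qform hn sys.
have [|A fA] := positive_form_sum_squares f qf.
  by move=> v v0; rewrite -hf exprn_gt0 // h_gt0.
have uA : A \in unitmx.
  rewrite -row_free_unit -kermx_eq0; apply/rowV0P => v /sub_kermxP vA.
  apply/eqP/negP => /negP /h_gt0 /(exprn_gt0 2).
  by rewrite hf fA vA dotp0l ltxx.
have uAT : A^T \in unitmx by rewrite unitmx_tr.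
(* Since h u is the norm of u A, it is the support function of the image of the ball under A^T. *)
exists 0, A^T; split; first by rewrite row_free_unit.
apply/seteqP; split=> [y Ly|_ [z z1 <-]] /=.
  exists (y *m invmx A^T); last by rewrite add0r mulmxKV.
  set z := y *m _; have yE : y = z *m A^T by rewrite mulmxKV.
  (* In this direction the support inequality reads z.z <= |z|, so z is in the unit ball. *)
  have := hmax (z *m invmx A) _ Ly.
  rewrite {1}yE dotp_mulr trmxK mulmxKV // => zh.
  have hz : h (z *m invmx A) ^+ 2 = dotp z z by rewrite hf fA mulmxKV.
  have := dotp_ge0 z; rewrite /euclidean_ball /=; nra.
rewrite add0r; apply: contrapT => /sep[u]; rewrite dotp_mulr trmxK ltNge => /negP.
apply; have := dotp_le_sqrt z (u *m A) z1.
rewrite -fA -hf sqrtr_sqr ger0_norm //; have [->|/h_gt0/ltW//] := eqVneq u 0.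
by rewrite (norm0 sys).
Qed.
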